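(* Define \[ \beta(3)=0.35296,\ \beta(4)=0.28688,\ \beta(5)=0.24647,\ \beta(6)=0.21851,\ \beta(7)=0.19732,\ \beta(8)=0.18068. \] Then for every integer $3\le m\le 8$, every simple digraph on $n$ vertices in which every vertex has outdegree at least $\beta(m)\cdot n$ contains a directed cycle of length at most $m$. Equivalently, $ch(m)\le\beta(m)$ for $3\le m\le 8$.
   Context: A simple digraph is a directed graph with no loops, no directed cycles of length $2$ (i.e. no pair of opposite edges $(u,v),(v,u)$), and no multiple edges. For an integer $m\ge 3$, $ch(m)$ denotes the smallest positive constant $c$ such that every simple digraph on $n\ge 3$ vertices all of whose outdegrees are at least $c\cdot n$ contains a directed cycle of length at most $m$. *)

(* Defs.v *)
From mathcomp Require Import all_boot all_order all_algebra.
From mathcomp Require Import boolp classical_sets reals.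

Set Implicit Arguments.
Unset Strict Implicit.
Unset Printing Implicit Defensive.

Import Order.TTheory GRing.Theory Num.Theory.
Local Open Scope classical_set_scope.
Local Open Scope ring_scope.

(* A digraph on the vertex set V is its edge relation, so there are no multiple
   edges by construction. *)
Definition simple_digraph (V : finType) (e : rel V) : Prop :=
  (forall u, ~~ e u u) /\ (forall u v, ~~ (e u v && e v u)).

Definition outdeg (V : finType) (e : rel V) (u : V) : nat := #|[set v | e u v]%SET|.

(* ucycle holds of the empty sequence, hence the bound 0 < size c. *)
Definition has_cycle_le (m : nat) (V : finType) (e : rel V) : Prop :=
  exists2 c : seq V, ucycle e c & (0 < size c <= m)%N.

Definition forces_cycle_le (R : realType) (m : nat) (c : R) : Prop :=
  forall (V : finType) (e : rel V),
    (3 <= #|V|)%N -> simple_digraph e ->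
    (forall u, c * #|V|%:R <= (outdeg e u)%:R) -> has_cycle_le m e.

(* The infimum is attained: see ch_least. *)
Definition ch (R : realType) (m : nat) : R :=
  inf [set c : R | 0 < c /\ forces_cycle_le m c].

Definition beta (R : realType) (m : nat) : R :=
  match m with
  | 3 => 35296%:R / 100000%:R
  | 4 => 28688%:R / 100000%:R
  | 5 => 24647%:R / 100000%:R
  | 6 => 21851%:R / 100000%:R
  | 7 => 19732%:R / 100000%:R
  | 8 => 18068%:R / 100000%:R
  | _ => 0
  end.

Lemma closed_walk_cycle (V : finType) (e : rel V) m x p :
  path e x p -> last x p = x -> (0 < size p <= m)%N -> has_cycle_le m e.
Proof.
case: p => [|y p] //= /andP[exy pyp] lyp szp.
case/shortenP: pyp lyp => q pyq uq sub lq.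
exists (y :: q).
  by rewrite /ucycle uq andbT /= rcons_path pyq lq exy.
rewrite /=; apply: leq_trans szp; rewrite ltnS.
apply: uniq_leq_size => //.
by case/andP: uq.
Qed.

Definition lexi_square (V : finType) (e : rel V) : rel (V * V) :=
  fun a b => e a.1 b.1 || (a.1 == b.1) && e a.2 b.2.

Lemma lexi_square_path (V : finType) (e : rel V) a p :
  path (lexi_square e) a p ->
  exists q, [/\ path e a.1 q, last a.1 q = (last a p).1, (size q <= size p)%N &
               q = [::] -> path e a.2 (map snd p)].
Proof.
elim: p a => [|b p IH] a /=; first by exists [::].
case/andP => ab /IH [q [pq lq sq nq]].
case/orP: ab => [eab|/andP[/eqP eab eab2]].
  by exists (b.1 :: q); rewrite /= eab; split.
exists q; rewrite eab; split => //; first exact: leqW.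
by move=> /nq ->; rewrite eab2.
Qed.

Lemma lexi_square_cycle (V : finType) (e : rel V) m :
  has_cycle_le m (lexi_square e) -> has_cycle_le m e.
Proof.
case=> -[//|a p] /andP[/= /lexi_square_path [q [pq lq sq nq]] _] szp.
rewrite last_rcons size_rcons in lq sq.
case: q pq lq sq nq => [|b q] pq lq sq nq.
  apply: (closed_walk_cycle (nq erefl)).
    by rewrite last_map last_rcons.
  by rewrite size_map size_rcons.
exact: (closed_walk_cycle pq lq (leq_trans sq szp)).
Qed.

Lemma lexi_square_simple (V : finType) (e : rel V) :
  simple_digraph e -> simple_digraph (lexi_square e).
Proof.
case=> irr asym; split=> [[a b]|[a b] [c d]]; rewrite /lexi_square /=.
  by rewrite eqxx (negPf (irr a)) (negPf (irr b)).
have := asym a c; have := asym b d; have := irr a.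
rewrite (eq_sym c a); case: eqP => [<-|_] /=.
  by move=> /negPf ->.
by rewrite !orbF.
Qed.

Lemma lexi_square_outdeg (V : finType) (e : rel V) (a : V * V) :
  simple_digraph e ->
  outdeg (lexi_square e) a = (outdeg e a.1 * #|V| + outdeg e a.2)%N.
Proof.
case=> irr _.
have -> : outdeg (lexi_square e) a =
    #|(finset.setX [set v | e a.1 v] [set: V] :|:
      finset.setX [set a.1] [set v | e a.2 v])%SET|.
  rewrite /outdeg; apply: eq_card => -[c d].
  by rewrite !inE /= andbT /lexi_square /= (eq_sym c).
rewrite cardsU !cardsX cardsT cards1 mul1n.
rewrite (_ : (_ :&: _)%SET = finset.set0) ?cards0 ?subn0 //.
apply/setP => -[c d]; rewrite !inE /= andbT.
by case: (eqVneq c a.1) => [->|_]; rewrite ?(negPf (irr _)) ?andbF.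
Qed.

Lemma forces_cycle_le1 (R : realType) m : forces_cycle_le m (1 : R).
Proof.
move=> V e V3 [irr _] /(_ _) deg.
have /card_gt0P[u _] : (0 < #|V|)%N by apply: leq_trans V3.
have := deg u; rewrite mul1r ler_nat leqNgt => /negP[].
rewrite /outdeg -cardsT; apply: proper_card.
rewrite finset.properT; apply: contraNneq (irr u) => uT.
by have := finset.in_setT u; rewrite -uT inE.
Qed.

Lemma directed_cycle_bound (R : realType) m (c : R) :
  forces_cycle_le m c -> m.+3%:R^-1 < c.
Proof.
move=> good; rewrite ltNge; apply/negP => cle.
pose e : rel 'I_m.+3 := frel (@ordS m.+3).
have iterS k (i : 'I_m.+3) : iter k (@ordS m.+3) i = ((i + k) %% m.+3)%N :> nat.
  elim: k => [|k IH]; first by rewrite addn0 modn_small.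
  by rewrite iterS /= IH -addn1 modnDml -addnA addn1.
have noiter k (i : 'I_m.+3) : (0 < k < m.+3)%N -> iter k (@ordS m.+3) i != i.
  case/andP => k0 km; apply/eqP => /(congr1 val) /=.
  rewrite iterS => /eqP; rewrite -[X in _ == X](modn_small (ltn_ord i)).
  rewrite -[X in _ == X %[mod _]]addn0 eqn_modDl mod0n modn_small //.
  by rewrite eqn0Ngt k0.
have [|||[//|x p]] := good _ e.
- by rewrite card_ord.
- split=> [u|u v]; first exact: (noiter 1%N).
  apply/negP => /= /andP[/eqP uv /eqP vu].
  by have := noiter 2%N u isT; rewrite /= uv vu eqxx.
- move=> u; rewrite card_ord.
  have -> : outdeg e u = 1%N.
    rewrite /outdeg -(cards1 (ordS u)); apply: eq_card => v.
    by rewrite !inE eq_sym.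
  by rewrite -ler_pdivlMr ?ltr0n // mul1r.
move=> /andP[/= pe _] szp.
have /fpathP[k pk] := pe.
have szk : size (rcons p x) = k by rewrite pk size_traject.
have := last_rcons x p x; rewrite pk.
case: k pk szk => [|k] pk; first by case: (p) pk.
rewrite size_rcons trajectSr last_rcons -iterSr => -[szk] /eqP.
apply/negP; apply: noiter; rewrite -szk /=.
apply: leq_ltn_trans szp _.
by rewrite ltnS leqW // leqW.
Qed.

Lemma ch_least (R : realType) m :
  [/\ 0 < ch R m, forces_cycle_le m (ch R m) &
     forall c : R, 0 < c -> forces_cycle_le m c -> ch R m <= c].
Proof.
pose S := [set c : R | 0 < c /\ forces_cycle_le m c].
have S0 : S !=set0 by exists 1; split; [exact: ltr01 | exact: forces_cycle_le1].
have lbS : lbound S m.+3%:R^-1 by move=> c [_ /directed_cycle_bound/ltW].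
have iS : has_inf S by split => //; exists (m.+3%:R^-1).
have ch0 : 0 < ch R m.
  by apply: (@lt_le_trans _ _ m.+3%:R^-1); [rewrite invr_gt0 | exact: lb_le_inf].
split=> [//||c c0 good]; last by apply: ge_inf; [exists (m.+3%:R^-1) | split].
move=> V e V3 se deg; apply: lexi_square_cycle.
have n0 : 0 < #|V|%:R :> R by rewrite ltr0n; apply: leq_trans V3.
have d0 : 0 < ch R m / #|V|%:R by rewrite divr_gt0.
have [c [c0 good] clt] := inf_adherent d0 iS.
apply: good.
- rewrite card_prod; apply: (leq_trans V3); rewrite leq_pmulr //.
  exact: leq_trans V3.
- exact: lexi_square_simple.
move=> a; rewrite lexi_square_outdeg // card_prod natrD !natrM mulrA.
have h : c * #|V|%:R <= ch R m * #|V|%:R + ch R m.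
  rewrite -[X in _ + X](divfK (lt0r_neq0 n0)) -mulrDl ler_pM2r //.
  exact: ltW.
apply: le_trans (ler_wpM2r (ltW n0) h) _.
by rewrite mulrDl; apply: lerD => //; rewrite ler_wpM2r // ltW.
Qed.

(* Main.v *)
Require Import Defs.
From mathcomp Require Import all_boot all_order all_algebra.
From mathcomp Require Import boolp reals ring lra zify.
Set Implicit Arguments.
Unset Strict Implicit.
Unset Printing Implicit Defensive.
Import Order.TTheory GRing.Theory Num.Theory.

(* Let alpha = beta m, and suppose that some digraph without cycles of length at
   most m has all outdegrees at least alpha n.  In a minimal such digraph, with
   outdegrees cut down to d, every proper set S of vertices contains a vertex
   with at most alpha |S| out-neighbours in S.  Hence a set Y of vertices at
   distance at most i from v can be enlarged, within distance i + 1, to a set of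
   size at least (1 - alpha) |Y| + d.  Given an arc uv, take w in
   N+(u) :&: N+(v) with the fewest out-neighbours x in that intersection: starting
   from N+(v) :|: N+(w), the enlarged set stays within distance m - 1 of both u and
   v, so it is disjoint from N-(u) :|: N-(v).  Summed over all arcs (Shen), this
   bounds the number of transitive triangles from below.

   The gain over x <= alpha |N+(u) :&: N+(v)| comes from feedback arc sets, as in
   Hamburger, Haxell and Kostochka.  In the spirit of Chudnovsky, Seymour and
   Sullivan, a vertex set with g nonadjacent pairs has an ordering with at most
   k g wrong arcs if k^2 - (m - 1) k + 1 <= 0.  So x^2 <= 2 k g, where g counts
   the nonadjacent pairs of N+(u), whereas if g is large then there are few
   transitive triangles.  For m = 8 one also starts from N+(v) :|: N+(w) with w of
   small outdegree inside N+(v), when v comes early in the ordering of N+(u). *)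

(** * Distance balls and spheres in a digraph without short cycles *)

Section Balls.
Variables (V : finType).
Implicit Types (e : rel V) (x y z v : V).

Definition transpose e : rel V := fun x y => e y x.

Fixpoint ball e i v : {set V} :=
  if i is j.+1 then ball e j v :|: [set y | [exists x in ball e j v, e x y]]
  else [set v].

Lemma ballS e i v : ball e i v \subset ball e i.+1 v.
Proof. exact: subsetUl. Qed.

Lemma ball_mono e i j v : (i <= j)%N -> ball e i v \subset ball e j v.
Proof.
move=> /subnKC <-; elim: (j - i)%N => [|n IH]; first by rewrite addn0.
by rewrite addnS; exact: subset_trans IH (ballS _ _ _).
Qed.

Lemma ball_leq e i j v x : (i <= j)%N -> x \in ball e i v -> x \in ball e j v.
Proof. by move/(ball_mono e v)/subsetP; exact. Qed.

Lemma ball_center e i v : v \in ball e i v.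
Proof. by apply: (subsetP (ball_mono e v (leq0n i))); rewrite inE. Qed.

Lemma ball_step e i v x y : x \in ball e i v -> e x y -> y \in ball e i.+1 v.
Proof. by move=> xB exy; rewrite !inE; apply/orP; right; apply/existsP; exists x; rewrite xB. Qed.

Lemma ballSP e i v y : y \in ball e i.+1 v ->
  y \in ball e i v \/ exists2 x, x \in ball e i v & e x y.
Proof.
rewrite /= !inE => /orP[|/existsP[x /andP[]]]; first by left.
by right; exists x.
Qed.

Lemma ball_arc e x y : e x y -> y \in ball e 1 x.
Proof. by apply: ball_step; rewrite inE. Qed.

Lemma ball_trans e i j x y z :
  y \in ball e i x -> z \in ball e j y -> z \in ball e (i + j) x.
Proof.
move=> xy; elim: j z => [|j IH] z; first by rewrite inE addn0 => /eqP->.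
case/ballSP=> [/IH zB|[w /IH wB ewz]]; rewrite addnS.
  exact: (subsetP (ballS _ _ _)).
exact: ball_step wB ewz.
Qed.

Lemma ball_path e i x y : y \in ball e i x ->
  exists p, [/\ path e x p, last x p = y & (size p <= i)%N].
Proof.
elim: i y => [|i IH] y; first by rewrite inE => /eqP->; exists [::].
case/ballSP=> [/IH[p [pp lp sp]]|[z /IH[p [pp lp sp]] ezy]].
  by exists p; split=> //; exact: leqW.
by exists (rcons p y); rewrite rcons_path last_rcons size_rcons pp lp.
Qed.

Lemma ball_transpose e i x y : (y \in ball (transpose e) i x) = (x \in ball e i y).
Proof.
have sub e' j u w : w \in ball (transpose e') j u -> u \in ball e' j w.
  elim: j w => [|j IH] w; first by rewrite !inE eq_sym.
  case/ballSP=> [/IH|[z /IH zB ewz]]; first exact: (subsetP (ballS _ _ _)).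
  by have := ball_trans (@ball_arc e' w z ewz) zB; rewrite add1n.
by apply/idP/idP => [|h]; [exact: sub | exact: (sub (transpose e))].
Qed.

(** A path of length at most [p] from [x] to [y], closed up by the arc from [y] to [x], is a closed
    walk of length at most [p + 1]; hence [m < p + 1]. *)
Lemma free_ball_arc e m p x y : ~ has_cycle_le m e ->
  y \in ball e p x -> e y x -> (m <= p)%N.
Proof.
move=> free /ball_path[q [pq lq sq]] eyx; rewrite leqNgt; apply/negP => pm.
apply: free; apply: (@closed_walk_cycle _ e m x (rcons q x)).
- by rewrite rcons_path pq lq.
- by rewrite last_rcons.
- by rewrite size_rcons /=; exact: leq_ltn_trans sq pm.
Qed.

Lemma free_ball e m p q x y : ~ has_cycle_le m e -> x != y ->
  y \in ball e p x -> x \in ball e q y -> (m < p + q)%N.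
Proof.
move=> free nxy xy; elim: q => [|q IH]; first by rewrite inE (negPf nxy).
case/ballSP=> [/IH h|[z yz ezx]]; first by rewrite addnS ltnW.
rewrite addnS ltnS; exact: (free_ball_arc free (ball_trans xy yz) ezx).
Qed.

Lemma free_irr e m : (0 < m)%N -> ~ has_cycle_le m e -> irreflexive e.
Proof.
move=> m0 free x; apply/negP => exx.
by have := free_ball_arc free (ball_center e 0 x) exx; rewrite leqNgt m0.
Qed.

Lemma free_asym e m x y : (1 < m)%N -> ~ has_cycle_le m e -> e x y -> e y x = false.
Proof.
move=> m1 free exy; apply/negP => eyx.
by have := free_ball_arc free (ball_arc exy) eyx; rewrite leqNgt m1.
Qed.

Lemma transpose_free e m : ~ has_cycle_le m e -> ~ has_cycle_le m (transpose e).
Proof.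
move=> free [[//|x c] /andP[/= pc _] sc]; apply: free.
apply: (@closed_walk_cycle _ e m x (rcons (rev c) x)).
- by have := rev_path e x (rcons c x); rewrite last_rcons belast_rcons rev_cons => ->.
- by rewrite last_rcons.
- by rewrite size_rcons size_rev.
Qed.

Lemma subrel_free e e' m : subrel e' e -> ~ has_cycle_le m e -> ~ has_cycle_le m e'.
Proof.
move=> sub free [c /andP[cc uc] sc]; apply: free; exists c => //.
by rewrite /ucycle (sub_cycle sub).
Qed.

(* y is at distance exactly p + 1 from x. *)
Definition sphere e p x y := (y \in ball e p.+1 x) && (y \notin ball e p x).

Lemma sphere_transpose e p x y : sphere (transpose e) p x y = sphere e p y x.
Proof. by rewrite /sphere !(ball_transpose e). Qed.

Lemma sphere_inj e p q x y : sphere e p x y -> sphere e q x y -> p = q.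
Proof.
wlog pq : p q / (p <= q)%N => [hw|].
  by case/orP: (leq_total p q) => h hp hq; [|symmetry]; exact: hw.
move=> /andP[hp _] /andP[_ hq]; apply/eqP; rewrite eqn_leq pq leqNgt /=.
by apply: contra hq => h; exact: (subsetP (ball_mono e x h)).
Qed.

Lemma sphere_neq e p x y : sphere e p x y -> x != y.
Proof. by case/andP=> _; apply: contraNneq => <-; exact: ball_center. Qed.

End Balls.

(** * Arcs and nonadjacent pairs across the boundary of a ball *)

Section Cuts.
Variables (V : finType).
Implicit Types (e : rel V) (x y z v : V) (A B C : {set V}).

Definition nonadj e x y := [&& x != y, ~~ e x y & ~~ e y x].
Definition arcs e B C : nat := \sum_(x in B) \sum_(y in C) e x y.
Definition miss e B C : nat := \sum_(x in B) \sum_(y in C) nonadj e x y.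

Lemma nonadjC e x y : nonadj e x y = nonadj e y x.
Proof. by rewrite /nonadj eq_sym; congr (_ && _); exact: andbC. Qed.

Lemma nonadj_transpose e x y : nonadj (transpose e) x y = nonadj e x y.
Proof. by rewrite nonadjC /nonadj /transpose eq_sym. Qed.

Lemma missC e B C : miss e B C = miss e C B.
Proof.
rewrite /miss exchange_big /=; apply: eq_bigr => x _; apply: eq_bigr => y _.
by rewrite nonadjC.
Qed.

Lemma miss_transpose e B C : miss (transpose e) B C = miss e B C.
Proof. by apply: eq_bigr => x _; apply: eq_bigr => y _; rewrite nonadj_transpose. Qed.

Lemma arcs_transpose e B C : arcs (transpose e) B C = arcs e C B.
Proof. exact: exchange_big. Qed.

(* [geodesics e j] is the number of triples (x, v, a) such that v is the
   penultimate vertex of a shortest path from x to a of length j + 2. *)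
Definition geodesics e j : nat :=
  \sum_v \sum_x \sum_a [&& sphere e j x v, e v a & sphere e j.+1 x a].

Lemma sum_exclusive (I : finType) (f : pred I) (b : bool) :
  (forall i, f i -> b) -> (forall i i', f i -> f i' -> i = i') ->
  (\sum_i f i <= b)%N.
Proof.
move=> fb ff; case: (pickP f) => [i fi|f0]; last by rewrite big1 // => i _; rewrite f0.
rewrite (bigD1 i) //= fi (fb _ fi) big1 // => i' ni; case fi': (f i') => //.
by rewrite (ff _ _ fi fi') eqxx in ni.
Qed.

Lemma sphere0 e m x y : (0 < m)%N -> ~ has_cycle_le m e -> sphere e 0 x y = e x y.
Proof.
move=> m0 free; apply/idP/idP => [/andP[]|exy].
  by case/ballSP=> [->//|[z]]; rewrite inE => /eqP->.
by rewrite /sphere (ball_arc exy) inE; apply: contraTneq exy => ->; rewrite (free_irr m0 free).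
Qed.

(** Reversing all arcs turns the penultimate vertex of a shortest path into its second vertex. *)
Lemma geodesics_transpose e m j : (0 < m)%N -> ~ has_cycle_le m e ->
  geodesics (transpose e) j =
  \sum_v \sum_x \sum_a [&& e x v, sphere e j v a & sphere e j.+1 x a].
Proof.
move=> m0 free; rewrite /geodesics; apply: eq_bigr => v _; rewrite [LHS]exchange_big /=.
apply: eq_bigr => x _; apply: eq_bigr => a _.
by rewrite !(sphere_transpose e) /transpose andbCA.
Qed.

Lemma geodesics0_transpose e m : (0 < m)%N -> ~ has_cycle_le m e ->
  geodesics (transpose e) 0 = geodesics e 0.
Proof.
move=> m0 free; rewrite (geodesics_transpose _ m0 free) /geodesics.
apply: eq_bigr => v _; apply: eq_bigr => x _; apply: eq_bigr => a _.
by rewrite !(sphere0 _ _ m0 free).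
Qed.

Variables (e : rel V) (m : nat) (A : {set V}).
Hypothesis m_gt2 : (2 < m)%N.
Hypothesis free : ~ has_cycle_le m e.
Hypothesis inA : forall x y, e x y -> (x \in A) && (y \in A).

Lemma ball_sub i v : v \in A -> ball e i v \subset A.
Proof.
move=> vA; elim: i => [|i IH]; first by rewrite sub1set.
apply/subsetP => y /ballSP[/(subsetP IH)//|[x _ /inA/andP[]//]].
Qed.

Lemma sphere_in p x y : sphere e p x y -> (x \in A) && (y \in A).
Proof.
move=> pxy; have nxy := sphere_neq pxy; case/andP: pxy => /ball_path[q [pq lq _]] _.
case: q pq lq => [_ /= xy|z q /= /andP[/inA/andP[-> zA] pq] <-]; first by rewrite xy eqxx in nxy.
by elim: q z zA pq => //= w q IH z _ /andP[/inA/andP[_ wA]]; exact: IH.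
Qed.

(** An arc leaving the ball starts on the boundary sphere: from any smaller distance its head would
    still lie inside. *)
Lemma arcs_ball j v : v \in A -> arcs e (ball e j.+1 v) (A :\: ball e j.+1 v) =
  \sum_b \sum_c [&& sphere e j v b, e b c & sphere e j.+1 v c].
Proof.
move=> vA; rewrite /arcs big_mkcond; apply: eq_bigr => b _.
case: ifP => bB; last by rewrite big1 // => c _; rewrite /sphere bB.
rewrite big_mkcond; apply: eq_bigr => c _; rewrite in_setD.
case ebc: (e b c); last by rewrite andbF; case: ifP.
rewrite /= /sphere bB (ball_step bB ebc) /=; have [_ ->] := andP (inA ebc); rewrite andbT.
case: ifP => cB; last by rewrite andbF.
by case: (boolP (b \in ball e j v)) => // /ball_step/(_ ebc) cB'; rewrite cB' in cB.
Qed.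

Lemma sum_arcs_ball j :
  \sum_(v in A) arcs e (ball e j.+1 v) (A :\: ball e j.+1 v) = geodesics e j.
Proof.
rewrite /geodesics [RHS]exchange_big /= [LHS]big_mkcond /=; apply: eq_bigr => v _.
case: ifP => vA; first by rewrite arcs_ball.
rewrite big1 // => b _; rewrite big1 // => c _.
by case vb: (sphere e j v b); rewrite //= (andP (sphere_in vb)).1 in vA.
Qed.

(** Each triple yields a pair [(x, a)] with [x] outside the ball and [a] inside, nonadjacent because
    an arc would shorten the path or close a short cycle. No pair arises twice: the distance from
    [x] to [a] fixes the index within each family, and [a] is an out-neighbour of [v] in the first
    family only. *)
Lemma miss_ball P j v : v \in A -> (j < m - 2)%N -> (P <= m - 2)%N -> (P + j < m)%N ->
  (\sum_(p < P) \sum_x \sum_a [&& sphere e p x v, e v a & sphere e p.+1 x a]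
   + \sum_(q < j) \sum_x \sum_a [&& e x v, sphere e q.+1 v a & sphere e q.+2 x a]
   <= miss e (ball e j.+1 v) (A :\: ball e j.+1 v))%N.
Proof.
move=> vA jm Pm Pj.
rewrite exchange_big [X in (_ + X <= _)%N]exchange_big -big_split /=.
rewrite missC /miss [X in (_ <= X)%N]big_mkcond /=; apply: leq_sum => x _.
rewrite exchange_big [X in (_ + X <= _)%N]exchange_big -big_split /=.
rewrite (_ : (if _ then _ else _) = \sum_a
    [&& x \in A :\: ball e j.+1 v, a \in ball e j.+1 v & nonadj e x a] :> nat); last first.
  case: ifP => xB /=; last by rewrite big1.
  by rewrite big_mkcond; apply: eq_bigr => a _; case: ifP.
apply: leq_sum => a _.
have nadj p : (p < m - 2)%N -> sphere e p.+1 x a -> nonadj e x a.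
  move=> pm xa; rewrite /nonadj (sphere_neq xa) /=; case/andP: xa => xa nxa.
  apply/andP; split; apply/negP => h.
    by case/negP: nxa; exact: ball_leq (ltn0Sn p) (ball_arc h).
  by have := free_ball_arc free xa h; lia.
have far p : (p + j + 2 <= m)%N -> sphere e p x v -> x \in A :\: ball e j.+1 v.
  move=> pm xv; rewrite in_setD (andP (sphere_in xv)).1 andbT; apply/negP => h.
  by have := free_ball free (sphere_neq xv) (andP xv).1 h; lia.
pose f (i : 'I_P + 'I_j) := match i with
  | inl p => [&& sphere e p x v, e v a & sphere e p.+1 x a]
  | inr q => [&& e x v, sphere e q.+1 v a & sphere e q.+2 x a] end.
rewrite (_ : (_ + _)%N = \sum_i f i)%N; last by rewrite big_sumType.
apply: sum_exclusive => [[p|q]|[p|q] [p'|q']] /=.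
- case/and3P=> xv eva xa; rewrite (far p) ?(nadj p) //; try by have := ltn_ord p; lia.
  by rewrite andbT /= (ball_leq (ltn0Sn j) (ball_arc eva)).
- case/and3P=> exv va xa; rewrite (nadj q.+1) //; last by have := ltn_ord q; lia.
  rewrite (far 0) ?(sphere0 _ _ _ free) //; try lia.
  by rewrite andbT /=; case/andP: va => va _; exact: ball_leq (ltn_ord q : q.+2 <= j.+1) va.
- by case/and3P=> h _ _ /and3P[h' _ _]; congr inl; apply/val_inj/(sphere_inj h h').
- case/and3P=> _ eva _ /and3P[_ /andP[_ /negP h] _]; case: h.
  exact: ball_leq (ltn0Sn _) (ball_arc eva).
- case/and3P=> _ /andP[_ /negP h] _ /and3P[_ eva _]; case: h.
  exact: ball_leq (ltn0Sn _) (ball_arc eva).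
- by case/and3P=> _ h _ /and3P[_ h' _]; congr inr; apply/val_inj; case: (sphere_inj h h').
Qed.

Lemma sum_miss_ball P j : (j < m - 2)%N -> (P <= m - 2)%N -> (P + j < m)%N ->
  (\sum_(p < P) geodesics e p + \sum_(q < j) geodesics (transpose e) q.+1
   <= \sum_(v in A) miss e (ball e j.+1 v) (A :\: ball e j.+1 v))%N.
Proof.
move=> jm Pm Pj.
under [X in (_ + X <= _)%N]eq_bigr => q _ do rewrite (geodesics_transpose _ _ free) ?(ltn_trans _ m_gt2) //.
rewrite /geodesics exchange_big [X in (_ + X <= _)%N]exchange_big -big_split /=.
rewrite [X in (_ <= X)%N]big_mkcond /=; apply: leq_sum => v _.
case: ifP => vA; first exact: miss_ball.
rewrite !big1 // => i _; rewrite big1 // => x _; rewrite big1 // => a _.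
  by case xv: (e x v); rewrite //= (andP (inA xv)).2 in vA.
by case xv: (sphere e i x v); rewrite //= (andP (sphere_in xv)).2 in vA.
Qed.

End Cuts.

(** * Sparse cuts: few arcs compared with the nonadjacent pairs across *)

Lemma ltr_sum1 (R : realFieldType) (I : finType) (P : pred I) (i : I) (F G : I -> R) :
  P i -> (forall i, P i -> F i <= G i)%R -> (F i < G i)%R ->
  (\sum_(i | P i) F i < \sum_(i | P i) G i)%R.
Proof.
move=> Pi FG FGi; rewrite (bigD1 i) // [ltRHS](bigD1 i) //=.
by apply: ltr_leD => //; apply: ler_sum => i' /andP[/FG].
Qed.

(** Multiplying the last inequality by [1 - k > 0] and inserting the one before eliminates [c] and
    leaves [n * (k ^+ 2 - (x + 3) * k + 1) > 0]. *)
Lemma sparse_cut_arith (R : realFieldType) (k x c n : R) : (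
  0 < k -> 0 <= x -> 0 <= c -> 0 <= n -> k ^+ 2 - (x + 3%:R) * k + 1 <= 0 ->
  k * (c + (x + 1) * n) < c -> k * (c + (x + 2%:R) * n) < n -> False)%R.
Proof.
move=> k0 x0 c0 n0 kr hc hn.
have p1 : (0 <= k * ((x + 1) * n))%R.
  by apply: mulr_ge0 (ltW k0) (mulr_ge0 _ n0); lra.
have hk : (0 < 1 - k)%R.
  by rewrite ltNge; apply/negP => k1; have := mulr_ge0_le0 c0 k1; lra.
have h1 : (k * (k * ((x + 1) * n)) < k * (c * (1 - k)))%R by rewrite ltr_pM2l //; lra.
have h2 : (k * c * (1 - k) < n * (1 - k * (x + 2%:R)) * (1 - k))%R by rewrite ltr_pM2r //; lra.
by have h3 := mulr_ge0_le0 n0 kr; lra.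
Qed.

Section SparseCut.
Variables (V : finType) (R : realFieldType) (k : R) (m : nat) (A : {set V}).
Hypothesis m_gt2 : 2 < m.
Hypothesis k_gt0 : (0 < k)%R.
Hypothesis k_root : (k ^+ 2 - m.-1%:R * k + 1 <= 0)%R.

Lemma geodesics_gt (e : rel V) P j :
  ~ has_cycle_le m e -> (forall x y, e x y -> (x \in A) && (y \in A)) ->
  1 < #|A| ->
  (forall B, B != set0 -> B \proper A ->
     k * (miss e B (A :\: B))%:R < (arcs e B (A :\: B))%:R)%R ->
  j < m - 2 -> P <= m - 2 -> P + j < m ->
  (k * (\sum_(p < P) geodesics e p + \sum_(q < j) geodesics (transpose e) q.+1)%:R
   < (geodesics e j)%:R)%R.
Proof.
move=> free inA A2 dense jm Pm Pj.
have [v vA] : exists v, v \in A by apply/set0Pn; rewrite -card_gt0 ltnW.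
have cut v' : v' \in A -> (k * (miss e (ball e j.+1 v') (A :\: ball e j.+1 v'))%:R
    <= (arcs e (ball e j.+1 v') (A :\: ball e j.+1 v'))%:R)%R.
  move=> v'A; have [->|nBA] := eqVneq (ball e j.+1 v') A.
    by rewrite setDv /miss !big1 ?mulr0 // => x _; rewrite big_set0.
  apply/ltW/dense; last by rewrite properEneq nBA (ball_sub inA).
  by apply/set0Pn; exists v'; exact: ball_center.
(* Strictness requires one ball that is a proper subset of [A]. The ball around the head [y] of an
   arc misses its tail [x], since a path back would close a short cycle. *)
have [x [y exy]] : exists x y, e x y.
  have pv : [set v] \proper A.
    by rewrite properEcard sub1set vA cards1.
  have v0 : [set v] != set0 by apply/set0Pn; exists v; rewrite inE.
  have := dense [set v] v0 pv.
  move=> /(le_lt_trans (mulr_ge0 (ltW k_gt0) (ler0n _ _))); rewrite ltr0n /arcs big_set1.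
  case: (pickP (e v)) => [y evy _|e0]; first by exists v, y.
  by rewrite big1 // => y _; rewrite e0.
have [xA yA] := andP (inA _ _ exy).
have nx : x \notin ball e j.+1 y.
  by apply/negP => h; have := free_ball_arc free h exy; lia.
apply: (@le_lt_trans _ _ (\sum_(v in A)
    k * (miss e (ball e j.+1 v) (A :\: ball e j.+1 v))%:R)%R).
  rewrite -mulr_sumr ler_pM2l // -natr_sum ler_nat.
  exact: (sum_miss_ball m_gt2 free inA).
rewrite -(sum_arcs_ball inA) natr_sum; apply: (ltr_sum1 yA) => //.
apply: dense; first by apply/set0Pn; exists y; exact: ball_center.
rewrite properE (ball_sub inA) //=; apply: contra nx => /subsetP; exact.
Qed.

(* Otherwise the average over v of the cuts around the balls of radius j + 1, in e
   and in its transpose, bounds each geodesic count below by k times a sum of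
   others; comparing with the smallest count nu contradicts the choice of k. *)
Lemma sparse_cut (e : rel V) :
  ~ has_cycle_le m e -> 1 < #|A| ->
  exists2 B, (B != set0) && (B \proper A) &
    ((arcs e B (A :\: B))%:R <= k * (miss e B (A :\: B))%:R)%R.
Proof.
move=> free A2.
apply: contrapT => noB.
pose f : rel V := fun x y => [&& x \in A, y \in A & e x y].
have freef : ~ has_cycle_le m f by apply: subrel_free free => x y /and3P[].
have inA x y : f x y -> (x \in A) && (y \in A) by case/and3P=> -> ->.
have densef B : B != set0 -> B \proper A ->
    (k * (miss f B (A :\: B))%:R < (arcs f B (A :\: B))%:R)%R.
  move=> B0 BA; have sBA := subsetP (proper_sub BA).
  have fe x y : x \in B -> y \in A :\: B -> (f x y = e x y) * (f y x = e y x).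
    by move=> /sBA xA /setDP[yA _]; rewrite /f xA yA.
  rewrite (_ : miss _ _ _ = miss e B (A :\: B)); last first.
    by apply: eq_bigr => x xB; apply: eq_bigr => y yB; rewrite /nonadj !(fe x y).
  rewrite (_ : arcs _ _ _ = arcs e B (A :\: B)); last first.
    by apply: eq_bigr => x xB; apply: eq_bigr => y yB; rewrite (fe x y).
  by rewrite ltNge; apply/negP => h; apply: noB; exists B; rewrite ?B0.
have freet := transpose_free freef.
have inAt x y : transpose f x y -> (x \in A) && (y \in A) by move/inA; rewrite andbC.
have denset B : B != set0 -> B \proper A ->
    (k * (miss (transpose f) B (A :\: B))%:R < (arcs (transpose f) B (A :\: B))%:R)%R.
  move=> B0 BA; have sBA := proper_sub BA.
  have eB : A :\: (A :\: B) = B by rewrite setDDr setDv set0U; apply/setIidPr.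
  rewrite miss_transpose arcs_transpose missC.
  have := densef (A :\: B); rewrite eB; apply.
    by case/properP: BA => _ [x xA xB]; apply/set0Pn; exists x; rewrite inE xB.
  rewrite properEneq subsetDl andbT; apply: contra_neq B0 => AB.
  by rewrite -eB AB setDv.
have k1 := geodesics_gt freef inA A2 densef.
have k2 := geodesics_gt freet inAt A2 denset.
pose c := geodesics f 0.
have c' : geodesics (transpose f) 0 = c.
  by rewrite /c (geodesics0_transpose (ltnW (ltnW m_gt2)) freef).
pose g (b : bool) j := if b then geodesics f j else geodesics (transpose f) j.
have lb b P j : j < m - 2 -> P < m - 2 -> P + j < m.-1 -> 
   (k * (c + \sum_(p < P) g b p.+1 + \sum_(q < j) g (~~ b) q.+1)%:R < (g b j)%:R)%R.
  move=> jm Pm Pj; case: b => /=.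
    by have := k1 P.+1 j; rewrite big_ord_recl; apply; lia.
  by have := k2 P.+1 j; rewrite big_ord_recl c'; apply; lia.
have [N mN] : exists N, m = N.+3 by exists (m - 3); lia.
move: k_root lb; rewrite mN /= => kr lb.
have c0 : (0 <= c%:R :> R)%R by exact: ler0n.
(* For [m = 3] only the count [c] is left: [kr] becomes [(k - 1) ^+ 2 <= 0], so [k = 1], while [lb]
   gives [k * c < c]. *)
case: N mN kr lb => [|N] mN kr lb.
  have := lb true 0 0 isT isT isT; rewrite !big_ord0 !addn0 -/c => h.
  have k1' : (k = 1)%R by nra.
  by rewrite k1' mul1r ltxx in h.
pose F (z : bool * 'I_N.+1) := g z.1 z.2.+1.
case: (@arg_minnP _ (true, ord0) xpredT F isT) => -[b j] _ Fmin.
set nu := F (b, j) in Fmin.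
have gnu b' (q : nat) : q < N.+1 -> nu <= g b' q.+1.
  by move=> qN; exact: (Fmin (b', Ordinal qN) isT).
have sumnu b' n : n <= N.+1 -> n * nu <= \sum_(q < n) g b' q.+1.
  move=> nN; rewrite -[X in X * _]card_ord -sum_nat_const; apply: leq_sum => q _.
  by apply: gnu; exact: leq_trans (ltn_ord q) nN.
have n0 : (0 <= nu%:R :> R)%R by exact: ler0n.
have hc : (k * (c%:R + N.+1%:R * nu%:R) < c%:R)%R.
  apply: le_lt_trans (lb true N.+1 0 _ _ _) => //; last by lia.
  rewrite big_ord0 addn0 ler_pM2l // -natrM -natrD ler_nat leq_add2l.
  exact: sumnu.
(* At the minimising index, the two sums in [lb] have [N + 2] terms altogether, each at least
   [nu]. *)
have hn : (k * (c%:R + N.+2%:R * nu%:R) < nu%:R)%R.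
  have jN := ltn_ord j.
  apply: le_lt_trans (lb b (N.+1 - j) j.+1 _ _ _); try by lia.
  rewrite ler_pM2l // -natrM -natrD ler_nat -addnA leq_add2l.
  apply: (@leq_trans ((N.+1 - j) * nu + j.+1 * nu)).
    by rewrite -mulnDl leq_mul2r; apply/orP; right; lia.
  by rewrite leq_add // sumnu //; lia.
rewrite -[N.+3]addn3 -?[N.+2]addn2 -?[N.+1]addn1 !natrD in hc hn kr.
exact: sparse_cut_arith k_gt0 (ler0n _ N) c0 n0 kr hc hn.
Qed.

End SparseCut.

(** * Rankings of a vertex set with few wrong arcs *)

Section Rankings.
Variables (V : finType) (e : rel V).
Implicit Types (A B S : {set V}) (rk : V -> nat).

Definition deg A x : nat := \sum_(y in A) e x y.
(** Arcs are meant to run from higher to lower rank; those counted here are the wrong ones. *)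
Definition back A rk x : nat := \sum_(y in A) (e x y && (rk x < rk y)).
Definition ranks A rk := {in A &, injective rk} /\ {in A, forall x, rk x < #|A|}.

Lemma perm_ranks A rk : ranks A rk -> perm_eq (map rk (enum A)) (iota 0 #|A|).
Proof.
case=> inj lt.
have u : uniq (map rk (enum A)).
  rewrite map_inj_in_uniq ?enum_uniq // => x y; rewrite !mem_enum; exact: inj.
have sub : {subset map rk (enum A) <= iota 0 #|A|}.
  by move=> i /mapP[x]; rewrite mem_enum mem_iota => /lt xA ->.
have [|_ h] := uniq_min_size u sub; first by rewrite size_map size_iota -cardE.
by apply: uniq_perm => //; exact: iota_uniq.
Qed.

Lemma sum_ranks (R : nmodType) A rk (g : nat -> R) : ranks A rk ->
  (\sum_(x in A) g (rk x) = \sum_(i < #|A|) g i)%R.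
Proof.
move=> /perm_ranks h; rewrite -big_enum /= -(big_map rk xpredT) (perm_big _ h) /=.
by rewrite -[X in iota 0 X]subn0 -/(index_iota _ _) big_mkord.
Qed.

(** An out-neighbour either has smaller rank, which leaves at most [rk x] choices, or is reached by
    a wrong arc. *)
Lemma deg_ranks A rk x : irreflexive e -> ranks A rk -> x \in A ->
  deg A x <= rk x + back A rk x.
Proof.
move=> irr rkA xA; have [inj lt] := rkA.
apply: (@leq_trans (\sum_(y in A) ((rk y < rk x) : nat) + back A rk x)).
  rewrite -big_split /=; apply: leq_sum => y yA.
  case exy: (e x y) => //=; case: (ltngtP (rk y) (rk x)) => // rk_yx; have yx := inj _ _ yA xA rk_yx.
  by rewrite yx irr in exy.
rewrite leq_add2r (sum_ranks (fun i => (i < rk x) : nat) rkA).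
suff -> : \sum_(i < #|A|) ((i < rk x) : nat) = minn #|A| (rk x) by exact: geq_minr.
by elim: #|A| => [|n IH]; rewrite ?big_ord0 ?min0n // big_ord_recr IH /=; lia.
Qed.

(** The vertex of rank [i] has at least [r - i] wrong arcs, and these numbers add up to
    [r (r + 1) / 2] over [i < r]. *)
Lemma min_deg_ranks A rk r : irreflexive e -> ranks A rk -> A != set0 ->
  (forall x, x \in A -> r <= deg A x) ->
  r ^ 2 <= (\sum_(x in A) back A rk x).*2.
Proof.
move=> irr rkA /set0Pn[w wA] hr.
have rA : r <= #|A|.
  apply: leq_trans (hr w wA) _; rewrite -sum1_card; apply: leq_sum => y _.
  exact: leq_b1.
apply: (@leq_trans (\sum_(i < r) (r - i)).*2).
  elim: r {hr rA} => [//|r IH]; rewrite big_ord_recl.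
  have -> : \sum_(i < r) (r.+1 - bump 0 i) = \sum_(i < r) (r - i) by apply: eq_bigr.
  by move: IH; rewrite -!mulnn -!muln2 subn0; lia.
rewrite leq_double; apply: (@leq_trans (\sum_(i < #|A|) (r - i))).
  rewrite -!(big_mkord xpredT (fun i => r - i)) (big_cat_nat _ rA) //=.
  exact: leq_addr.
rewrite -(sum_ranks (fun i => r - i) rkA); apply: leq_sum => x xA.
by have := hr x xA; have := deg_ranks irr rkA xA; lia.
Qed.

Lemma sum_set_setD (A B : {set V}) (F : V -> nat) : B \subset A ->
  \sum_(x in A) F x = \sum_(x in B) F x + \sum_(x in A :\: B) F x.
Proof. by move=> /setIidPr BA; rewrite (big_setID B) BA. Qed.

Lemma miss_setD (A B : {set V}) : B \subset A ->
  miss e A A = miss e B B + miss e (A :\: B) (A :\: B) + (miss e B (A :\: B)).*2.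
Proof.
move=> BA; rewrite {1}/miss (sum_set_setD _ BA).
under eq_bigr => x _ do rewrite (sum_set_setD _ BA).
under [X in _ + X]eq_bigr => x _ do rewrite (sum_set_setD _ BA).
rewrite !big_split /= -!/(miss _ _ _) [miss _ (_ :\: _) B]missC -addnn; lia.
Qed.

(** Split [A] along a sparse cut and rank [B] below [C] recursively. The only wrong arcs between the
    parts go from [B] to [C]. The factor 2 is there because [miss e A A] counts ordered pairs. *)
Lemma feedback_ranking (R : realFieldType) (k : R) m A :
  2 < m -> (0 < k)%R -> (k ^+ 2 - m.-1%:R * k + 1 <= 0)%R -> ~ has_cycle_le m e ->
  exists2 rk, ranks A rk &
    ((\sum_(x in A) back A rk x)%:R *+ 2 <= k * (miss e A A)%:R)%R.
Proof.
move=> m2 k0 kr free; move: {2}#|A| (leqnn #|A|) => n.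
elim: n A => [|n IH] A An.
  move: An; rewrite leqn0 cards_eq0 => /eqP->.
  exists (fun=> 0); first by split=> x; rewrite inE.
  by rewrite big_set0 mul0rn mulr_ge0 ?(ltW k0).
have [A1|A1] := leqP #|A| 1.
  exists (fun=> 0).
    split=> [x y xA yA _|x xA]; first exact: (card_le1_eqP A1).
    by rewrite card_gt0; apply/set0Pn; exists x.
  by rewrite !big1 ?mul0rn ?mulr_ge0 ?(ltW k0) // => x _; rewrite /back big1 // => y _; rewrite andbF.
have [B /andP[B0 pBA] cut] := sparse_cut m2 k0 kr free A1.
have BA := proper_sub pBA; set C := A :\: B in cut.
have cAB : #|A| = #|B| + #|C| by rewrite -(cardsID B A) (setIidPr BA).
have ltBA := proper_card pBA; have B1 : 0 < #|B| by rewrite card_gt0.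
have [rk1 [inj1 lt1] b1] : exists2 rk, ranks B rk &
    ((\sum_(x in B) back B rk x)%:R *+ 2 <= k * (miss e B B)%:R)%R by apply: IH; lia.
have [rk2 [inj2 lt2] b2] : exists2 rk, ranks C rk &
    ((\sum_(x in C) back C rk x)%:R *+ 2 <= k * (miss e C C)%:R)%R by apply: IH; lia.
pose rk x := if x \in B then rk1 x else #|B| + rk2 x.
have rkB x : x \in B -> rk x = rk1 x by rewrite /rk => ->.
have rkC x : x \in C -> rk x = #|B| + rk2 x by case/setDP=> _; rewrite /rk => /negPf->.
have inBC x : x \in A -> x \in B \/ x \in C.
  by move=> xA; rewrite /C inE xA andbT; case: (x \in B); [left|right].
exists rk.
  split=> [x y xA yA|x xA].
    case: (inBC x xA) => xB; case: (inBC y yA) => yB.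
    - by rewrite (rkB x xB) (rkB y yB); exact: inj1.
    - rewrite (rkB x xB) (rkC y yB) => h.
      by move: (lt1 x xB); rewrite ltnNge h leq_addr.
    - rewrite (rkC x xB) (rkB y yB) => h.
      by move: (lt1 y yB); rewrite ltnNge -h leq_addr.
    - by rewrite (rkC x xB) (rkC y yB) => /addnI; exact: inj2.
  rewrite cAB; case: (inBC x xA) => xB; first rewrite (rkB x xB).
    exact: leq_trans (lt1 x xB) (leq_addr _ _).
  by rewrite (rkC x xB) ltn_add2l; exact: lt2.
rewrite (_ : \sum_(x in A) _ =
  \sum_(x in B) back B rk1 x + \sum_(x in C) back C rk2 x + arcs e B C); last first.
  rewrite (sum_set_setD _ BA) addnAC -big_split /=; congr (_ + _); apply: eq_bigr => x xB.
    rewrite /back (sum_set_setD _ BA); congr (_ + _); apply: eq_bigr => y yB.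
      by rewrite !rkB.
    by rewrite rkB // rkC // (leq_trans (lt1 x xB)) ?leq_addr // andbT.
  rewrite /back (sum_set_setD _ BA) big1 ?add0n => [|y yB].
    by apply: eq_bigr => y yB; rewrite !rkC // ltn_add2l.
  by rewrite rkC // rkB // ltnNge (leq_trans (ltnW (lt1 y yB))) ?leq_addr // andbF.
rewrite (miss_setD BA) -/C -addnn !natrD.
by move: b1 b2 cut; lra.
Qed.

End Rankings.

(** * Counting pairs, and the quantities of the final estimate *)

Section Density.
Variables (V : finType) (e : rel V).
Implicit Types (S : {set V}).

Definition outs u : {set V} := [set v | e u v].
Definition ins v : {set V} := [set u | e u v].

Lemma deg_card S u : deg e S u = #|S :&: outs u|.
Proof.
rewrite -sum1_card /deg [LHS]big_mkcond [RHS]big_mkcond.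
by apply: eq_bigr => y _; rewrite !inE; case: (y \in S); case: (e u y).
Qed.

Lemma missS S S' : S \subset S' -> miss e S S <= miss e S' S'.
Proof. by move=> /miss_setD->; rewrite -addnA leq_addr. Qed.

(** An ordered pair from [S] is an arc, a reversed arc, a nonadjacent pair or a diagonal pair, and
    only one of these. *)
Lemma count_pairs S : irreflexive e -> (forall x y, e x y -> e y x = false) ->
  (\sum_(x in S) deg e S x).*2 + miss e S S + #|S| = #|S| ^ 2.
Proof.
move=> irr asym.
have -> : #|S| ^ 2 = \sum_(x in S) \sum_(y in S) 1 by rewrite !sum_nat_const muln1.
have degT : \sum_(x in S) deg e S x = \sum_(x in S) \sum_(y in S) e y x.
  exact: exchange_big.
rewrite -addnn {2}degT /miss /deg -!big_split /= -sum1_card -big_split /=.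
apply: eq_bigr => x xS.
rewrite [X in _ + X = _](_ : 1 = \sum_(y in S) (x == y)); last first.
  rewrite (bigD1 x) //= eqxx big1 // => y /andP[_ yx].
  by rewrite eq_sym (negPf yx).
rewrite -!big_split /=; apply: eq_bigr => y _.
rewrite /nonadj; case: eqVneq => [<-|_] /=; first by rewrite irr.
by case exy: (e x y); [rewrite (asym _ _ exy) | case: (e y x)].
Qed.

End Density.

Local Open Scope ring_scope.

(** The right-hand side is the integral of [min(t, z)] over [t] from 0 to [n]. *)
Lemma sum_min_le (R : realFieldType) (z : R) n : 0 <= z -> z <= n%:R ->
  \sum_(i < n) Num.min i%:R z <= z * n%:R - z ^+ 2 / 2%:R.
Proof.
move=> z0; elim: n => [|n IH] zn.
  have -> : z = 0 by apply/eqP; rewrite eq_le z0 zn.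
  by rewrite big_ord0 mul0r expr0n mul0r subr0.
rewrite big_ord_recr /=; have [zn'|nz] := leP z n%:R.
  by have := IH zn'; rewrite -natr1; nra.
have sumn : (\sum_(i < n) i%:R : R) = n%:R * (n%:R - 1) / 2%:R.
  elim: (n) => [|j IHj]; first by rewrite big_ord0 mul0r mul0r.
  by rewrite big_ord_recr IHj /= -natr1; field.
have : \sum_(i < n) Num.min i%:R z <= \sum_(i < n) i%:R.
  by apply: ler_sum => i _; rewrite ge_min lexx.
rewrite sumn; have n0 : 0 <= n%:R :> R by exact: ler0n.
by move: zn nz n0; rewrite -natr1; nra.
Qed.

(* The contribution of a vertex u to the sum of the arc inequalities, divided by
   d^2, where [z * alpha * d] is the bound on x for the arcs leaving u, [g * d^2]
   the number of ordered nonadjacent pairs in N+(u), [D * d] the indegree, and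
   [l * d] the number of arcs wu on which u is early in the ordering of N+(w).  The term
   [3 (D - 1)], which sums to zero, has been added, so that D enters via (D - 1)^2. *)
Definition vertex_weight (R : fieldType) m (alpha k lam rho tau z g l D : R) : R :=
  let b := (1 - alpha) ^+ (m - 3) in
  b / alpha - b - 2%:R - (D - 1) ^+ 2 + (1 - b + b * (lam * alpha)) * ((1 - g) / 2%:R)
  + b * ((1 - lam) * (alpha * (z - z ^+ 2 / 2%:R))
         + ((1 - lam) * alpha + rho) * (k * g / 2%:R) - (1 - alpha) * (tau ^+ 2 / 2%:R)
         + l * ((1 - alpha) * tau - alpha * (1 - z) / (1 - alpha))).

(** * Growing a set from an arc *)

Section Vertices.
Variables (V : finType) (e : rel V) (R : rcfType) (m : nat) (alpha k : R).
Variables (A : {set V}) (d : nat).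
Hypothesis m_gt2 : (2 < m)%N.
Hypothesis free : ~ has_cycle_le m e.
Hypothesis inA : forall x y, e x y -> (x \in A) && (y \in A).
Hypothesis outd : forall u, u \in A -> #|outs e u| = d.
Hypothesis alpha01 : 0 < alpha < 1.
Hypothesis light : forall S, S != set0 -> S \proper A ->
  exists2 w, w \in S & (deg e S w)%:R <= alpha * #|S|%:R.
Hypothesis k_gt0 : 0 < k.
Hypothesis k_root : k ^+ 2 - m.-1%:R * k + 1 <= 0.

Let irr : irreflexive e. Proof. exact: free_irr (ltnW (ltnW m_gt2)) free. Qed.
Let asym x y : e x y -> e y x = false. Proof. exact: free_asym (ltnW m_gt2) free. Qed.

(** A vertex of minimum outdegree within [S] meets both bounds: the first by comparison with a light
    vertex, the second by applying [min_deg_ranks] to a feedback ranking of [S]. *)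
Lemma min_deg_vertex S : S != set0 -> S \proper A ->
  exists w, [/\ w \in S, (deg e S w)%:R <= alpha * #|S|%:R &
    (deg e S w)%:R ^+ 2 <= k * (miss e S S)%:R].
Proof.
move=> S0 SA; have [w0 w0S lw0] := light S0 SA.
case: (arg_minnP (deg e S) w0S) => w wS wmin; exists w; split=> //.
  by apply: le_trans lw0; rewrite ler_nat wmin.
have [rk rkS brk] := feedback_ranking S m_gt2 k_gt0 k_root free.
apply: le_trans brk; rewrite -natrX -mulrnA ler_nat muln2.
exact: min_deg_ranks rkS S0 wmin.
Qed.

Lemma outs_sub u : outs e u \subset A.
Proof. by apply/subsetP => v; rewrite inE => /inA/andP[]. Qed.

Lemma ins_sub u : ins e u \subset A.
Proof. by apply/subsetP => v; rewrite inE => /inA/andP[]. Qed.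

(** Adding the out-neighbours of a light vertex of [Y] gives size at least [(1 - alpha) * #|Y| + d];
    the bound iterates this affine map, whose fixed point is [d / alpha]. The set stays proper
    because it never contains [u]. *)
Lemma ball_growth u v i j (Y : {set V}) : e u v -> (i + j < m)%N -> Y != set0 ->
  (forall y, y \in Y -> (y \in ball e i v) && (y \in ball e i u)) ->
  exists2 Y' : {set V},
    (forall y, y \in Y' -> (y \in ball e (i + j) v) && (y \in ball e (i + j) u)) &
    (1 - alpha) ^+ j * #|Y|%:R + (1 - (1 - alpha) ^+ j) * (d%:R / alpha) <= #|Y'|%:R.
Proof.
move=> euv; elim: j i Y => [|j IH] i Y ijm Y0 Yball.
  by exists Y; rewrite ?addn0 // expr0 subrr mul0r mul1r addr0.
have [uA vA] := andP (inA euv).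
have YA : Y \proper A.
  rewrite properE; apply/andP; split.
    apply/subsetP => y /Yball/andP[yv _].
    exact: (subsetP (ball_sub inA _ vA)) yv.
  apply/negP => /subsetP/(_ _ uA)/Yball/andP[uv _].
  by have := free_ball_arc free uv euv; lia.
have [w wY lw] := light Y0 YA.
have wA : w \in A by exact: (subsetP (proper_sub YA)).
have [|||Y' Y'ball Y'card] := IH i.+1 (Y :|: outs e w).
- by rewrite addSnnS.
- by apply/set0Pn; exists w; rewrite inE wY.
- have [wv wu] := andP (Yball w wY).
  move=> y; rewrite in_setU => /orP[/Yball/andP[yv yu]|].
    by rewrite !(ball_leq (leqnSn i)).
  by rewrite inE => ewy; rewrite !(@ball_step _ e i _ w).
exists Y'; first by rewrite -addSnnS.
apply: le_trans Y'card.
have cY : #|Y :|: outs e w|%:R + (deg e Y w)%:R = #|Y|%:R + d%:R :> R.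
  by rewrite -!natrD deg_card cardsUI outd.
have [a0 a1] := andP alpha01.
have p0 : 0 <= (1 - alpha) ^+ j by apply: exprn_ge0; lra.
have da : alpha * (d%:R / alpha) = d%:R :> R by rewrite mulrC divfK // gt_eqF.
rewrite exprS.
have : (1 - alpha) ^+ j * ((1 - alpha) * #|Y|%:R + d%:R) <=
       (1 - alpha) ^+ j * #|Y :|: outs e w|%:R by apply: ler_wpM2l => //; lra.
by rewrite -{1}da; lra.
Qed.

(** These are the transitive triangles in which [uv] is the arc avoiding the source. *)
Definition common_ins u v : nat := #|ins e u :&: ins e v|.

Lemma arc_bound u v i (Y : {set V}) : e u v -> (i < m)%N -> Y != set0 ->
  (forall y, y \in Y -> (y \in ball e i v) && (y \in ball e i u)) ->
  (1 - alpha) ^+ (m.-1 - i) * #|Y|%:R + (1 - (1 - alpha) ^+ (m.-1 - i)) * (d%:R / alpha)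
  <= #|A|%:R - #|ins e v|%:R - #|ins e u|%:R + (common_ins u v)%:R.
Proof.
move=> euv im Y0 Yball.
have eim : (i + (m.-1 - i) = m.-1)%N by lia.
have [|Y' Y'ball Y'card] := @ball_growth u v i (m.-1 - i) Y euv _ Y0 Yball; first by lia.
apply: le_trans Y'card _; rewrite eim in Y'ball.
have [uA vA] := andP (inA euv).
have Y'A : Y' \subset A.
  by apply/subsetP => y /Y'ball/andP[/(subsetP (ball_sub inA _ vA))].
have dis : [disjoint Y' & ins e u :|: ins e v].
  rewrite -setI_eq0; apply/eqP/setP => y; rewrite !inE; apply/negP => /andP[/Y'ball/andP[yv yu]].
  have mm : (m <= m.-1)%N = false by rewrite leqNgt ltn_predL (ltn_trans _ m_gt2).
  by case/orP => ey; [have := free_ball_arc free yu ey | have := free_ball_arc free yv ey]; rewrite mm.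
have : (#|Y'| + #|ins e u :|: ins e v| <= #|A|)%N.
  rewrite -cardsUI (_ : _ :&: _ = finset.set0) ?cards0 ?addn0; last by apply/eqP; rewrite setI_eq0.
  by apply: subset_leq_card; rewrite !subUset Y'A !ins_sub.
have /(congr1 (fun n => n%:R : R)) := cardsUI (ins e u) (ins e v).
by rewrite -(ler_nat R) !natrD -/(common_ins u v); lra.
Qed.

Let outs_neq0 u v : e u v -> outs e v != finset.set0.
Proof.
move=> euv; have [uA vA] := andP (inA euv).
by rewrite -card_gt0 outd // -(outd uA); apply/card_gt0P; exists v; rewrite inE.
Qed.

Lemma arc_bound_triangles u v : e u v -> exists x : nat,
  [/\ x%:R <= alpha * (deg e (outs e u) v)%:R,
      x%:R ^+ 2 <= k * (miss e (outs e u) (outs e u))%:R &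
  (1 - alpha) ^+ (m - 3) * (d%:R + (deg e (outs e u) v)%:R - x%:R)
    + (1 - (1 - alpha) ^+ (m - 3)) * (d%:R / alpha)
  <= #|A|%:R - #|ins e v|%:R - #|ins e u|%:R + (common_ins u v)%:R].
Proof.
move=> euv; have [uA vA] := andP (inA euv); have [a0 a1] := andP alpha01.
set S := outs e u :&: outs e v; rewrite deg_card -/S.
have p0 : 0 <= (1 - alpha) ^+ (m - 3) by apply: exprn_ge0; lra.
have -> : (m - 3 = m.-1 - 2)%N by clear -m_gt2; lia.
have outs_v y : y \in outs e v -> (y \in ball e 2 v) && (y \in ball e 2 u).
  rewrite inE => evy; rewrite (ball_leq (isT : (1 <= 2)%N) (ball_arc evy)) /=.
  exact: ball_step (ball_arc euv) evy.
have [S0|S0] := eqVneq S finset.set0.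
  exists 0%N; rewrite S0 cards0 mulr0 expr0n subr0 addr0; split=> //.
    by rewrite mulr_ge0 // ltW.
  by have := arc_bound euv m_gt2 (outs_neq0 euv) outs_v; rewrite outd.
have SA : S \proper A.
  rewrite properE (subset_trans (subsetIl _ _) (outs_sub _)) /=.
  by apply/negP => /subsetP/(_ _ uA); rewrite !inE irr.
have [w [wS xS xM]] := min_deg_vertex S0 SA.
move: (wS); rewrite !inE => /andP[euw evw]; have [_ wA] := andP (inA euw).
exists (deg e S w); split=> //.
  apply: le_trans xM _; rewrite ler_pM2l // ler_nat; apply: missS; exact: subsetIl.
have Yball y : y \in outs e v :|: outs e w -> (y \in ball e 2 v) && (y \in ball e 2 u).
  rewrite in_setU => /orP[/outs_v//|]; rewrite inE => ewy.
  by rewrite !(@ball_step _ e 1 _ w) // ball_arc.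
have Y0 : outs e v :|: outs e w != finset.set0.
  by apply: contraNneq (outs_neq0 euv) => Y0; rewrite -subset0 -Y0 subsetUl.
apply: le_trans (arc_bound euv m_gt2 Y0 Yball); rewrite lerD2r.
have -> : (m.-1 - 2 = m - 3)%N by clear -m_gt2; lia.
apply: ler_wpM2l => //.
have cU := cardsUI (outs e v) (outs e w).
(* A common out-neighbour of [v] and [w] lies in [S], where there are [deg e S w] of them, or
   outside [N+(u)], where [v] has only [d - #|S|] out-neighbours. *)
have cI : (#|outs e v :&: outs e w| <= deg e S w + #|outs e v :\: outs e u|)%N.
  rewrite deg_card; apply: leq_trans (leq_card_setU _ _); apply: subset_leq_card.
  by apply/subsetP => y; rewrite !inE => /andP[-> ->]; rewrite /= !andbT orbN.
have cD := cardsID (outs e u) (outs e v).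
rewrite !outd // in cU cD; rewrite [outs e v :&: outs e u]setIC -/S in cD.
have : (d + #|S| <= #|outs e v :|: outs e w| + deg e S w)%N.
  by clear -cU cI cD; lia.
by rewrite -(ler_nat R) !natrD; lra.
Qed.

(** Here [w] is taken in all of [N+(v)], so [N+(w)] is only known to be within distance 3 of [u] and
    one growth step is lost. Rewriting the bound with exponent [m - 3] produces the division by
    [1 - alpha]. *)
Lemma arc_bound_second u v : (3 < m)%N -> e u v -> exists x : nat,
  [/\ x%:R <= alpha * d%:R,
      x%:R ^+ 2 <= k * (miss e (outs e v) (outs e v))%:R &
  (1 - alpha) ^+ (m - 3) * ((d%:R - x%:R) / (1 - alpha))
    + (1 - (1 - alpha) ^+ (m - 3)) * (d%:R / alpha)
  <= #|A|%:R - #|ins e v|%:R - #|ins e u|%:R + (common_ins u v)%:R].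
Proof.
move=> m3 euv; have [uA vA] := andP (inA euv); have [a0 a1] := andP alpha01.
have SA : outs e v \proper A.
  rewrite properE outs_sub /=.
  by apply/negP => /subsetP/(_ _ vA); rewrite !inE irr.
have [w [wS xS xM]] := min_deg_vertex (outs_neq0 euv) SA.
move: (wS); rewrite inE => evw; have [_ wA] := andP (inA evw).
exists (deg e (outs e v) w); split=> //; first by rewrite outd in xS.
have Yball y : y \in outs e v :|: outs e w -> (y \in ball e 3 v) && (y \in ball e 3 u).
  suff: y \in outs e v :|: outs e w -> y \in ball e 2 v.
    move=> h /h yv; apply/andP; split; first exact: (@ball_leq _ e 2 3 v y isT yv).
    exact: (@ball_trans _ e 1 2 u v y (ball_arc euv) yv).
  rewrite in_setU => /orP[]; rewrite [_ \in outs _ _]inE => h.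
    exact: (@ball_leq _ e 1 2 v y isT (ball_arc h)).
  exact: (@ball_step _ e 1 v w y (ball_arc evw) h).
have Y0 : outs e v :|: outs e w != finset.set0.
  by apply: contraNneq (outs_neq0 euv) => Y0; rewrite -subset0 -Y0 subsetUl.
have := arc_bound euv m3 Y0 Yball.
have -> : (m.-1 - 3 = m - 4)%N by clear -m3; lia.
have -> : (m - 3 = (m - 4).+1)%N by clear -m3; lia.
have cU := cardsUI (outs e v) (outs e w); rewrite -deg_card !outd // in cU.
have {cU} -> : #|outs e v :|: outs e w|%:R = d%:R + d%:R - (deg e (outs e v) w)%:R :> R.
  by apply/eqP; rewrite eq_sym subr_eq -!natrD cU.
apply: le_trans; rewrite exprS; set p := (1 - alpha) ^+ _.
set x := (deg _ _ _)%:R; set D := d%:R.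
rewrite le_eqVlt; apply/orP; left; apply/eqP; field.
by apply/andP; split; lra.
Qed.

(** * Bounding single arcs by means of rankings *)

(** [lam] is the weight of the bound on [x] by triangles against the bound by ranks, [tau * d] the
    rank below which an arc is early, and [rho] an extra charge on wrong arcs. With [tau = 0] no arc
    is early. *)
Variables (lam rho tau : R).
Hypothesis lam01 : 0 <= lam <= 1.
Hypothesis rho_ge0 : 0 <= rho.
Hypothesis tau01 : 0 <= tau <= 1.
Hypothesis tau_rho : tau = 0 \/ (3 < m)%N /\ 1 - alpha <= rho.

Definition gaps u : R := (miss e (outs e u) (outs e u))%:R.
(* The common upper bound on x for the arcs leaving u is [alpha * cap u]; the
   value is kept above [alpha * tau * d] so that it does not bind on early arcs. *)
Definition cap u : R :=
  Num.min d%:R (Num.max (tau * d%:R) (Num.sqrt (k * gaps u) / alpha)).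

Let d_ge0 : 0 <= d%:R :> R. Proof. exact: ler0n. Qed.

Lemma cap_bounds u : tau * d%:R <= cap u <= d%:R.
Proof.
have [t0 t1] := andP tau01.
by rewrite /cap le_min ge_min lexx le_max lexx orTb !andbT ler_piMl.
Qed.

Lemma cap_ge u (x : R) : 0 <= x -> x <= alpha * d%:R -> x ^+ 2 <= k * gaps u ->
  x <= alpha * cap u.
Proof.
move=> x0 xd xM; have [a0 a1] := andP alpha01.
rewrite mulrC -ler_pdivrMr // /cap le_min ler_pdivrMr // mulrC xd /= le_max.
rewrite ler_pM2r ?invr_gt0 // -(ger0_norm x0) -sqrtr_sqr ler_sqrt ?xM ?orbT //.
by rewrite mulr_ge0 ?ler0n // ltW.
Qed.

Lemma cap_cases u : (alpha * cap u) ^+ 2 <= k * gaps u \/ cap u = tau * d%:R.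
Proof.
have [a0 a1] := andP alpha01; have [t0 t1] := andP tau01.
have kM : 0 <= k * gaps u by rewrite mulr_ge0 ?ler0n // ltW.
rewrite /cap; case: (leP (tau * d%:R) (Num.sqrt (k * gaps u) / alpha)) => h; last first.
  by right; apply/min_idPr; rewrite ler_piMl.
left; rewrite -[leRHS]sqr_sqrtr // ler_sqr ?nnegrE ?sqrtr_ge0 //.
  by rewrite mulrC -ler_pdivlMr // ge_min lexx orbT.
by rewrite mulr_ge0 ?(ltW a0) // le_min d_ge0 (le_trans _ h) // mulr_ge0.
Qed.

Let b := (1 - alpha) ^+ (m - 3).
Definition excess u v : R :=
  #|A|%:R - #|ins e v|%:R - #|ins e u|%:R + (common_ins u v)%:R - (1 - b) * (d%:R / alpha).
Definition early (rk : V -> nat) v : bool := (rk v)%:R < tau * d%:R.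
(** On early arcs the first term cancels the [- tau * d] in [deficit]; the second is the surplus
    over [d] of [(d - x) / (1 - alpha)] at [x = alpha * cap v]. *)
Definition gain v : R :=
  (1 - alpha) * (tau * d%:R) - alpha * (d%:R - cap v) / (1 - alpha).
(* For an arc uv, [d + t - deficit] is a lower bound on the effective size of the set
   grown from, where t is the number of triangles on uv. *)
Definition deficit u (rk : V -> nat) v : R :=
  lam * (alpha * (deg e (outs e u) v)%:R)
  + (1 - lam) * (alpha * Num.min (rk v)%:R (cap u) + alpha * (back e (outs e u) rk v)%:R)
  + (1 - alpha) * (Num.min (rk v)%:R (tau * d%:R) - tau * d%:R)
  + rho * (back e (outs e u) rk v)%:R + (early rk v)%:R * gain v.

Lemma excess_ge u rk v : e u v -> ranks (outs e u) rk ->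
  b * (d%:R + (deg e (outs e u) v)%:R - deficit u rk v) <= excess u v.
Proof.
move=> euv rku; have [a0 a1] := andP alpha01; have [l0 l1] := andP lam01.
have b0 : 0 <= b by apply: exprn_ge0; lra.
have [zl zu] := andP (cap_bounds u).
have vu : v \in outs e u by rewrite inE.
have := deg_ranks irr rku vu; rewrite -(ler_nat R) natrD /deficit /early.
have [uA vA] := andP (inA euv).
have tD : (deg e (outs e u) v)%:R <= d%:R :> R.
  by rewrite ler_nat deg_card -(outd uA) subset_leq_card // subsetIl.
have B0 : 0 <= (back e (outs e u) rk v)%:R :> R by exact: ler0n.
move: B0 tD; set B : R := (back _ _ _ _)%:R; set i : R := (rk v)%:R.
set t : R := (deg _ _ _)%:R => B0 tD tiB.
(* Early arcs rely on [arc_bound_second], the others on [arc_bound_triangles]. *)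
rewrite /excess lerBrDr; case: ltP => [itau|taui].
  have [tau0|[m3 rho_ge]] := tau_rho.
    by move: itau; rewrite tau0 mul0r ltNge ler0n.
  have [x [xd xM]] := arc_bound_second m3 euv; apply: le_trans; rewrite lerD2r.
  apply: ler_wpM2l => //.
  have xz := cap_ge (ler0n _ _) xd xM.
  rewrite (min_idPl (le_trans (ltW itau) zl)) mul1r /gain.
  have e1 : (d%:R - x%:R) / (1 - alpha) = d%:R + (alpha * d%:R - x%:R) / (1 - alpha).
    by field; lra.
  have e2 : alpha * (d%:R - cap v) / (1 - alpha) =
     (alpha * d%:R - x%:R) / (1 - alpha) - (alpha * cap v - x%:R) / (1 - alpha).
    by field; lra.
  have e3 : 0 <= (alpha * cap v - x%:R) / (1 - alpha).
    by rewrite divr_ge0; lra.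
  have h1 : (1 - alpha) * B <= rho * B by apply: ler_wpM2r.
  have h2 : (1 - lam) * (alpha * t) <= (1 - lam) * (alpha * (i + B)).
    by apply: ler_wpM2l; [lra | apply: ler_wpM2l => //; exact: ltW].
  have h3 : (1 - alpha) * t <= (1 - alpha) * (i + B) by apply: ler_wpM2l => //; lra.
  by rewrite e1 e2; lra.
have [x [xt xM]] := arc_bound_triangles euv; apply: le_trans; rewrite lerD2r.
apply: ler_wpM2l => //; rewrite subrr mulr0 mul0r !addr0.
have xz : x%:R <= alpha * cap u.
  apply: cap_ge => //.
  by apply: le_trans xt _; apply: ler_wpM2l => //; exact: ltW.
(* For late arcs, [x] is bounded both by [alpha * t] and by this rank bound; the two are averaged
   with weights [lam] and [1 - lam]. *)
have h0 : x%:R <= alpha * Num.min i (cap u) + alpha * B.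
  rewrite -mulrDr; have [_|_] := leP i (cap u).
    by apply: le_trans xt _; apply: ler_wpM2l => //; exact: ltW.
  by apply: le_trans xz _; apply: ler_wpM2l; [exact: ltW | lra].
have h1 : lam * x%:R <= lam * (alpha * t) by apply: ler_wpM2l.
have h2 := ler_wpM2l (_ : 0 <= 1 - lam) h0.
have h3 : 0 <= rho * B by exact: mulr_ge0.
by have := h2 ltac:(lra); lra.
Qed.

(** * Summation over all arcs *)

Definition triangles u : R := \sum_(v in outs e u) (deg e (outs e u) v)%:R.

Lemma triangles_le u : u \in A -> 2%:R * triangles u + gaps u <= d%:R ^+ 2.
Proof.
move=> uA; have /(congr1 (fun n => n%:R : R)) := count_pairs (outs e u) irr asym.
rewrite /triangles /gaps -natr_sum -muln2 !natrD natrM natrX outd //.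
by have := d_ge0; lra.
Qed.

Lemma sum_deficit u rk : u \in A -> ranks (outs e u) rk ->
  (\sum_(v in outs e u) back e (outs e u) rk v)%:R *+ 2 <= k * gaps u ->
  \sum_(v in outs e u) deficit u rk v <=
    lam * (alpha * triangles u) + (1 - lam) * (alpha * (cap u * d%:R - cap u ^+ 2 / 2%:R))
    - (1 - alpha) * ((tau * d%:R) ^+ 2 / 2%:R) + ((1 - lam) * alpha + rho) * (k * gaps u / 2%:R)
    + \sum_(v in outs e u) (early rk v)%:R * gain v.
Proof.
move=> uA rku; rewrite natr_sum /deficit !big_split /= -!mulr_sumr !big_split /= -!mulr_sumr.
rewrite sumr_const outd //.
rewrite (sum_ranks (fun i => Num.min i%:R (cap u)) rku).
rewrite (sum_ranks (fun i => Num.min i%:R (tau * d%:R)) rku) outd //.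
have [a0 a1] := andP alpha01; have [l0 l1] := andP lam01; have [t0 t1] := andP tau01.
have [zl zu] := andP (cap_bounds u).
have z0 : 0 <= cap u by apply: le_trans zl; rewrite mulr_ge0.
have h1 := sum_min_le z0 zu.
have h2 := @sum_min_le _ (tau * d%:R) d (mulr_ge0 t0 d_ge0) ltac:(by rewrite ler_piMl).
rewrite -/(triangles u); set B := \sum_(v in outs e u) _ => hB.
have h3 : ((1 - lam) * alpha + rho) * B <= ((1 - lam) * alpha + rho) * (k * gaps u / 2%:R).
  apply: ler_wpM2l; last by lra.
  by rewrite addr_ge0 // mulr_ge0 ?(ltW a0) //; lra.
have h4 : (1 - lam) * (alpha * \sum_(i < d) Num.min i%:R (cap u)) <=
    (1 - lam) * (alpha * (cap u * d%:R - cap u ^+ 2 / 2%:R)).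
  by apply: ler_wpM2l; [lra | apply: ler_wpM2l => //; exact: ltW].
have h5 : (1 - alpha) * (\sum_(i < d) Num.min i%:R (tau * d%:R)) <=
   (1 - alpha) * (tau * d%:R * d%:R - (tau * d%:R) ^+ 2 / 2%:R).
  by apply: ler_wpM2l => //; lra.
by rewrite -[- _ *+ d]mulr_natr; lra.
Qed.

Lemma sum_arcs_exchange (F : V -> V -> R) :
  \sum_(u in A) \sum_(v in outs e u) F u v = \sum_(v in A) \sum_(u in ins e v) F u v.
Proof.
rewrite (exchange_big_dep (mem A)) /= => [|u v uA]; last first.
  by rewrite inE => /inA/andP[].
apply: eq_bigr => v vA; apply: eq_bigl => u.
by rewrite !inE; case: (boolP (e u v)) => [/inA/andP[-> _]//|]; rewrite andbF.
Qed.

(** Both sides count transitive triangles, on the left by the arc from middle to sink, on the right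
    by the arc from source to middle. *)
Lemma sum_common_ins :
  \sum_(u in A) \sum_(v in outs e u) (common_ins u v)%:R = \sum_(u in A) triangles u.
Proof.
rewrite /triangles; under eq_bigr => u _ do rewrite -natr_sum.
under [RHS]eq_bigr => u _ do rewrite -natr_sum.
rewrite -!natr_sum; congr (_%:R).
have allV (F : V -> V -> nat) : (\sum_(u in A) \sum_(v in outs e u) F u v =
    \sum_u \sum_v (e u v) * F u v)%N.
  rewrite [LHS]big_mkcond; apply: eq_bigr => u _.
  rewrite big_mkcond -[LHS]/(if _ then _ else _); case: ifP => uA.
    by apply: eq_bigr => v _; rewrite inE; case: (e u v); rewrite ?mul1n.
  rewrite big1 // => v _; case euv: (e u v) => //.
  by rewrite (andP (inA euv)).1 in uA.
rewrite !allV.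
have -> : (\sum_u \sum_v e u v * common_ins u v =
    \sum_u \sum_v \sum_w e u v * (e w u * e w v))%N.
  apply: eq_bigr => u _; apply: eq_bigr => v _; rewrite -big_distrr /=; congr (_ * _)%N.
  rewrite /common_ins -sum1_card big_mkcond; apply: eq_bigr => w _.
  by rewrite !inE; case: (e w u); case: (e w v).
have -> : (\sum_w \sum_u e w u * deg e (outs e w) u =
    \sum_w \sum_u \sum_v e u v * (e w u * e w v))%N.
  apply: eq_bigr => w _; apply: eq_bigr => u _; rewrite /deg big_mkcond big_distrr /=.
  apply: eq_bigr => v _; rewrite inE.
  by case: (e w u); case: (e w v); case: (e u v).
rewrite [RHS]exchange_big /=; apply: eq_bigr => u _; exact: exchange_big.
Qed.

Lemma sum_excess : \sum_(u in A) \sum_(v in outs e u) excess u v =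
  \sum_(u in A) (d%:R * #|A|%:R - #|ins e u|%:R ^+ 2 - d%:R * #|ins e u|%:R
    + triangles u - d%:R * ((1 - b) * (d%:R / alpha))).
Proof.
have eu u : u \in A -> \sum_(v in outs e u) excess u v =
  d%:R * #|A|%:R - \sum_(v in outs e u) #|ins e v|%:R - d%:R * #|ins e u|%:R
  + \sum_(v in outs e u) (common_ins u v)%:R - d%:R * ((1 - b) * (d%:R / alpha)).
  move=> uA; have cst (x : R) : \sum_(v in outs e u) x = d%:R * x.
    by rewrite sumr_const outd // mulr_natl.
  by rewrite /excess !(sumrB, big_split) /= !cst.
have sq : \sum_(u in A) \sum_(v in outs e u) #|ins e v|%:R = \sum_(v in A) #|ins e v|%:R ^+ 2 :> R.
  rewrite (sum_arcs_exchange (fun _ v => #|ins e v|%:R)); apply: eq_bigr => v vA.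
  by rewrite sumr_const expr2 mulr_natr.
by rewrite (eq_bigr _ eu) !(sumrB, big_split) /= sq sum_common_ins.
Qed.

Lemma sum_card_ins : \sum_(v in A) #|ins e v|%:R = \sum_(u in A) d%:R :> R.
Proof.
have := sum_arcs_exchange (fun _ _ => 1).
under eq_bigr => u uA do rewrite sumr_const outd //.
by under [RHS]eq_bigr => v _ do rewrite sumr_const.
Qed.

Hypothesis A_neq0 : A != finset.set0.
Hypothesis d_ge : alpha * #|A|%:R <= d%:R.
Hypothesis vertex_lt0 : forall z g l D : R,
  tau <= z <= 1 -> 0 <= g -> (alpha * z) ^+ 2 <= k * g \/ z = tau -> 0 <= l <= D ->
  vertex_weight m alpha k lam rho tau z g l D < 0.

Lemma vertex_sum_lt0 w (l : R) : w \in A -> 0 <= l <= #|ins e w|%:R ->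
  d%:R * (d%:R / alpha) - #|ins e w|%:R ^+ 2 - d%:R * #|ins e w|%:R
    + triangles w - d%:R * ((1 - b) * (d%:R / alpha)) + 3%:R * d%:R * (#|ins e w|%:R - d%:R)
  - b * (d%:R ^+ 2 + triangles w - (lam * (alpha * triangles w)
    + (1 - lam) * (alpha * (cap w * d%:R - cap w ^+ 2 / 2%:R))
    - (1 - alpha) * ((tau * d%:R) ^+ 2 / 2%:R) + ((1 - lam) * alpha + rho) * (k * gaps w / 2%:R)
    + l * gain w)) < 0.
Proof.
move=> wA /andP[l0 lD]; have [a0 a1] := andP alpha01; have [l0' l1'] := andP lam01.
have d0 : 0 < d%:R :> R.
  apply: lt_le_trans d_ge; rewrite mulr_gt0 // ltr0n card_gt0 //.
have dn : d%:R != 0 :> R by rewrite gt_eqF.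
have d2 : 0 < d%:R ^+ 2 :> R by rewrite exprn_gt0.
have M0 : 0 <= gaps w by exact: ler0n.
have tri := triangles_le wA.
have [zl zu] := andP (cap_bounds w); have zc := cap_cases w.
have b01 : 0 <= b <= 1 by rewrite exprn_ge0 ?exprn_ile1 //; lra.
rewrite /gain; move: (triangles w) (cap w) (gaps w) (#|ins e w|%:R : R) M0 tri zl zu zc lD.
move=> T z' g' D' M0 tri zl zu zc lD.
have [z ez] : exists z, z' = z * d%:R by exists (z' / d%:R); rewrite divfK.
have [g eg] : exists g, g' = g * d%:R ^+ 2 by exists (g' / d%:R ^+ 2); rewrite divfK // gt_eqF.
have [D eD] : exists D, D' = D * d%:R by exists (D' / d%:R); rewrite divfK.
have [l' el] : exists l', l = l' * d%:R by exists (l / d%:R); rewrite divfK.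
subst z' g' D' l.
rewrite !ler_pM2r ?pmulr_lge0 // in zl l0 lD M0.
have z1 : z <= 1 by rewrite -(ler_pM2r d0) mul1r.
have zc' : (alpha * z) ^+ 2 <= k * g \/ z = tau.
  case: zc => [h|/(mulIf dn)]; [left|by right].
  by rewrite -(ler_pM2r d2) -exprMn -!mulrA.
have := vertex_lt0 (z := z) (g := g) (l := l') (D := D).
rewrite zl z1 l0 lD /vertex_weight -/b => /(_ isT M0 zc' isT) num.
have c0 : 0 <= 1 - b + b * (lam * alpha).
  by have [b0 b1] := andP b01; rewrite addr_ge0 ?mulr_ge0 ?subr_ge0 // ltW.
have tri' : (1 - b + b * (lam * alpha)) * T <=
    (1 - b + b * (lam * alpha)) * (d%:R ^+ 2 * ((1 - g) / 2%:R)) by apply: ler_wpM2l => //; lra.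
have num' := mulr_gt0 d2 (_ : 0 < - _); have {num'} := num' _ ltac:(rewrite oppr_gt0; exact: num).
move: tri'.
(* With the inverses turned into variables, the goal is the weight inequality times [d ^+ 2]
   combined with [tri']. *)
move: (alpha^-1) ((1 - alpha)^-1) => ia ic h1 h2.
lra.
Qed.

(** The sum of [excess_ge] over all arcs has nonnegative slack, but grouped by vertices this slack
    is at most a sum of terms made negative by [vertex_sum_lt0]. *)
Lemma no_dense_digraph : False.
Proof.
have [rk rkP] := choice (fun u => let: ex_intro2 rk h1 h2 :=
  feedback_ranking (outs e u) m_gt2 k_gt0 k_root free in
  ex_intro (fun rk => ranks (outs e u) rk /\
    (\sum_(v in outs e u) back e (outs e u) rk v)%:R *+ 2 <= k * gaps u) rk (conj h1 h2)).
(* As [gain] depends on the head of an arc only, early arcs are collected at their heads. *)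
pose l v : R := \sum_(u in ins e v) (early (rk u) v)%:R.
pose Q w := lam * (alpha * triangles w)
    + (1 - lam) * (alpha * (cap w * d%:R - cap w ^+ 2 / 2%:R))
    - (1 - alpha) * ((tau * d%:R) ^+ 2 / 2%:R) + ((1 - lam) * alpha + rho) * (k * gaps w / 2%:R).
have b0 : 0 <= b by apply: exprn_ge0; have [_ a1] := andP alpha01; lra.
have [w0 w0A] := set0Pn _ A_neq0.
have lins w : 0 <= l w <= #|ins e w|%:R.
  apply/andP; split; first by apply: sumr_ge0 => u _; exact: ler0n.
  rewrite /l -natr_sum ler_nat -sum1_card; apply: leq_sum => u _; exact: leq_b1.
have := ltr_sum1 w0A (fun w wA => ltW (vertex_sum_lt0 wA (lins w))) (vertex_sum_lt0 w0A (lins w0)).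
rewrite big1_eq ltNge => /negP; apply.
apply: (@le_trans _ _ (\sum_(u in A) \sum_(v in outs e u)
    (excess u v - b * (d%:R + (deg e (outs e u) v)%:R - deficit u (rk u) v)))).
  apply: sumr_ge0 => u uA; apply: sumr_ge0 => v; rewrite inE => euv.
  by rewrite subr_ge0; apply: excess_ge => //; case: (rkP u).
under eq_bigr => u _ do rewrite sumrB -mulr_sumr.
rewrite sumrB sum_excess -mulr_sumr.
have low : \sum_(u in A) (d%:R ^+ 2 + triangles u - Q u) - \sum_(w in A) l w * gain w <=
  \sum_(u in A) \sum_(v in outs e u) (d%:R + (deg e (outs e u) v)%:R - deficit u (rk u) v).
  have -> : \sum_(w in A) l w * gain w =
      \sum_(u in A) \sum_(v in outs e u) (early (rk u) v)%:R * gain v.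
    by rewrite sum_arcs_exchange; apply: eq_bigr => w _; rewrite mulr_suml.
  rewrite -sumrB; apply: ler_sum => u uA; rewrite sumrB big_split /= sumr_const outd //.
  rewrite -/(triangles u) expr2 mulr_natr; have [rku brk] := rkP u.
  by have := sum_deficit uA rku brk; rewrite -/(Q u); lra.
have := ler_wpM2l b0 low.
(* Replacing [#|A|] by [d / alpha] can only increase the total, and the added linear term vanishes
   since indegrees and outdegrees have the same sum. *)
rewrite [X in _ -> _ <= X](_ : _ = \sum_(w in A) (d%:R * #|A|%:R - #|ins e w|%:R ^+ 2
      - d%:R * #|ins e w|%:R + triangles w - d%:R * ((1 - b) * (d%:R / alpha)))
    - b * (\sum_(w in A) (d%:R ^+ 2 + triangles w - Q w) - \sum_(w in A) l w * gain w)
    + (\sum_(w in A) d%:R * (d%:R / alpha - #|A|%:R)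
      + 3%:R * d%:R * (\sum_(w in A) #|ins e w|%:R - \sum_(w in A) d%:R))); last first.
  rewrite -!sumrB !mulr_sumr -sumrB -!big_split /=.
  by apply: eq_bigr => w _; rewrite /Q; ring.
rewrite sum_card_ins subrr mulr0 addr0.
have : 0 <= \sum_(w in A) d%:R * (d%:R / alpha - #|A|%:R).
  apply: sumr_ge0 => w _; apply: mulr_ge0 => //; have [a0 a1] := andP alpha01.
  by rewrite subr_ge0 ler_pdivlMr // mulrC.
lra.
Qed.

End Vertices.

(** * Negativity of the vertex weights *)

(** The terms in [l] and [D] are nonpositive when [rho = tau = 0]. Inserting
    [g >= (alpha * z) ^+ 2 / k] leaves a quadratic in [z], and the inequality on [k * c1 ^+ 2] says
    that its discriminant is negative. *)
Lemma vertex_weight_lt0 (R : realFieldType) m (alpha k lam z g l D : R) :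
  let b : R := (1 - alpha) ^+ (m - 3) in
  let c : R := 1 - b + b * (lam * alpha) in
  let c0 : R := b / alpha - b - 2%:R + c / 2%:R in
  let c1 : R := b * ((1 - lam) * alpha) in
  0 < alpha < 1 -> 0 < k -> 0 <= c1 -> c1 * k <= c -> c0 < 0 ->
  k * c1 ^+ 2 < - (2%:R * (c1 * k + alpha ^+ 2 * (c - c1 * k)) * c0) ->
  0 <= z <= 1 -> 0 <= g -> (alpha * z) ^+ 2 <= k * g \/ z = 0 -> 0 <= l <= D ->
  vertex_weight m alpha k lam 0 0 z g l D < 0.
Proof.
move=> b c c0 c1 /andP[a0 a1] k0 c1_ge0 c1k c0_lt0 disc /andP[z0 z1] g0 zg /andP[l0 lD].
have b0 : 0 <= b by apply: exprn_ge0; lra.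
have lz : 0 <= b * (l * (alpha * (1 - z) / (1 - alpha))).
  by apply/mulr_ge0/mulr_ge0 => //; apply: divr_ge0; rewrite ?mulr_ge0 //; lra.
apply: (@le_lt_trans _ _ (c0 + c1 * (z - z ^+ 2 / 2%:R) - (c - c1 * k) * g / 2%:R)).
  rewrite /vertex_weight -/b -/c /c0 /c1.
  by have sqD := sqr_ge0 (D - 1); lra.
have cg : 0 <= (c - c1 * k) * g by rewrite mulr_ge0 ?subr_ge0.
case: zg => [zg|->]; last first.
  by rewrite expr0n mul0r subr0 mulr0 addr0 subr_lt0 (lt_le_trans c0_lt0) // divr_ge0.
set q := c1 * k + alpha ^+ 2 * (c - c1 * k) in disc.
have q_ge0 : 0 <= q by apply: addr_ge0; apply: mulr_ge0; rewrite ?subr_ge0 ?sqr_ge0 ?(ltW k0).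
have q0 : 0 < q.
  rewrite lt_def q_ge0 andbT; apply: contraTneq disc => ->; rewrite mulr0 mul0r oppr0 -leNgt.
  by rewrite mulr_ge0 ?sqr_ge0 ?(ltW k0).
have zg' : (c - c1 * k) * (alpha * z) ^+ 2 <= (c - c1 * k) * (k * g).
  by rewrite ler_wpM2l ?subr_ge0.
have qk : 0 < 2%:R * k * q by rewrite !mulr_gt0.
rewrite -(pmulr_rlt0 _ qk).
have sq := sqr_ge0 (c1 * k - q * z).
have qzg := ler_wpM2l q_ge0 zg'.
have kd : k * (k * c1 ^+ 2) < k * - (2%:R * q * c0) by rewrite ltr_pM2l.
move: sq qzg kd; rewrite /q; lra.
Qed.

Lemma vertex_weight8 (R : realFieldType) (z g l D : R) :
  let alpha := 18068%:R / 100000%:R in let k := 146%:R / 1000%:R in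
  let tau := 12%:R / 100%:R in
  tau <= z <= 1 -> 0 <= g -> (alpha * z) ^+ 2 <= k * g \/ z = tau -> 0 <= l <= D ->
  vertex_weight 8 alpha k 0 (81932%:R / 100000%:R) tau z g l D < 0.
Proof.
move=> alpha k tau /andP[z0 z1] g0 zg /andP[l0 lD].
have ca : 1 - alpha = 81932%:R / 100000%:R by rewrite /alpha; lra.
rewrite /vertex_weight ca !(subSS, subn0, sub0n); rewrite /alpha /k /tau in z0 zg *.
have lz : 0 <= l * (1 - z) by apply: mulr_ge0; lra.
have sqD := sqr_ge0 (D - 1).
(* For fixed [l], and [g] as small as [zg] permits, the weight is largest near
   [z = 0.341 + 0.416 l]. *)
have sqz := sqr_ge0 (z - 341%:R / 1000%:R - 416%:R / 1000%:R * l).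
case: zg => [zg|z_eq].
  have [l1|l1] := leP l 1.
    have ll : 0 <= l * (1 - l) by apply: mulr_ge0; lra.
    lra.
  (* Since [D >= l > 1], this gives [(D - 1) ^+ 2 >= (l - 1) ^+ 2]; the remaining quadratic in [l]
     peaks close to 1.01. *)
  have Dl : 0 <= (D - l) * (D + l - 2%:R) by apply: mulr_ge0; lra.
  have sql := sqr_ge0 (l - 1010%:R / 1000%:R).
  lra.
by rewrite z_eq; clear sqz lz; lra.
Qed.

(** * The minimal counterexample and the choice of parameters *)

Lemma sparse_vertex (V : finType) (e : rel V) (R : rcfType) m (alpha k lam rho tau : R) :
  (2 < m)%N -> ~ has_cycle_le m e -> 0 < alpha < 1 ->
  0 < k -> k ^+ 2 - m.-1%:R * k + 1 <= 0 ->
  0 <= lam <= 1 -> 0 <= rho -> 0 <= tau <= 1 ->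
  tau = 0 \/ (3 < m)%N /\ 1 - alpha <= rho ->
  (forall z g l D : R, tau <= z <= 1 -> 0 <= g ->
     (alpha * z) ^+ 2 <= k * g \/ z = tau -> 0 <= l <= D ->
     vertex_weight m alpha k lam rho tau z g l D < 0) ->
  forall A : {set V}, A != finset.set0 ->
  exists2 u, u \in A & (deg e A u)%:R < alpha * #|A|%:R.
Proof.
move=> m2 free alpha01 k0 kr lam01 rho0 tau01 tau_rho weight A.
move: {2}#|A|.+1 (ltnSn #|A|) => n; elim: n A => [//|n IH] A An A0.
apply: contrapT => dense.
have degA u : u \in A -> alpha * #|A|%:R <= (deg e A u)%:R.
  by move=> uA; rewrite leNgt; apply/negP => h; apply: dense; exists u.
have [u0 u0A] := set0Pn _ A0.
case: (arg_minnP (deg e A) u0A) => w wA wmin; set d := deg e A w in wmin.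
(* Every vertex of [A] keeps exactly [d] of its out-neighbours in [A]. Deleting arcs creates no
   cycle and raises no degree, so the induction hypothesis still provides light vertices in proper
   subsets. *)
pose f : rel V := fun u v => (u \in A) && (v \in take d (enum (A :&: outs e u))).
have fe u v : f u v -> [/\ u \in A, v \in A & e u v].
  by case/andP=> uA /mem_take; rewrite mem_enum !inE => /andP[vA euv].
have freef : ~ has_cycle_le m f by apply: subrel_free free => u v /fe[].
apply: (@no_dense_digraph V f R m alpha k A d m2 freef _ _ alpha01 _ k0 kr
  lam rho tau lam01 rho0 tau01 tau_rho A0 (degA w wA) weight).
- by move=> u v /fe[-> ->].
- move=> u uA; have le_d : (d <= size (enum (A :&: outs e u)))%N.
    by rewrite -cardE -deg_card wmin.
  rewrite -[RHS](size_takel le_d) -(card_uniqP (take_uniq d (enum_uniq _))).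
  by apply: eq_card => v; rewrite inE /f uA.
- move=> S S0 SA; have [|v vS lv] := IH S _ S0.
    by apply: leq_trans (proper_card SA) _.
  exists v => //; apply: le_trans (ltW lv); rewrite ler_nat; apply: leq_sum => y _.
  by case fvy: (f v y) => //; have [_ _ ->] := fe _ _ fvy.
Qed.

Lemma sparse_vertex_beta (V : finType) (e : rel V) (R : realType) m :
  (3 <= m <= 8)%N -> ~ has_cycle_le m e -> forall A : {set V}, A != finset.set0 ->
  exists2 u, u \in A & (deg e A u)%:R < beta R m * #|A|%:R.
Proof.
move=> /andP[m3 m8] free A A0; move: m3 m8 free.
case: m => [|[|[|[|[|[|[|[|[|m]]]]]]]]] // _ _ free.
(* In each case [k] is the smaller root of [k ^+ 2 - (m - 1) * k + 1], rounded up to three decimals.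
   Early arcs occur for [m = 8] only, with [rho = 1 - alpha]. *)
- apply: (@sparse_vertex V e R 3 (35296%:R / 100000%:R) 1 (5%:R / 6%:R) 0 0 isT free) A0.
  + by apply/andP; split; lra.
  + by lra.
  + by rewrite [_.-1]/=; lra.
  + by apply/andP; split; lra.
  + by lra.
  + by apply/andP; split; lra.
  + by left.
  + by move=> z g l D; apply: vertex_weight_lt0; rewrite ?(subSS, subn0, sub0n); lra.
- apply: (@sparse_vertex V e R 4 (28688%:R / 100000%:R) (382%:R / 1000%:R) (1 / 3%:R) 0 0 isT free) A0.
  + by apply/andP; split; lra.
  + by lra.
  + by rewrite [_.-1]/=; lra.
  + by apply/andP; split; lra.
  + by lra.
  + by apply/andP; split; lra.
  + by left.
  + by move=> z g l D; apply: vertex_weight_lt0; rewrite ?(subSS, subn0, sub0n); lra.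
- apply: (@sparse_vertex V e R 5 (24647%:R / 100000%:R) (268%:R / 1000%:R) 0 0 0 isT free) A0.
  + by apply/andP; split; lra.
  + by lra.
  + by rewrite [_.-1]/=; lra.
  + by apply/andP; split; lra.
  + by lra.
  + by apply/andP; split; lra.
  + by left.
  + by move=> z g l D; apply: vertex_weight_lt0; rewrite ?(subSS, subn0, sub0n); lra.
- apply: (@sparse_vertex V e R 6 (21851%:R / 100000%:R) (209%:R / 1000%:R) 0 0 0 isT free) A0.
  + by apply/andP; split; lra.
  + by lra.
  + by rewrite [_.-1]/=; lra.
  + by apply/andP; split; lra.
  + by lra.
  + by apply/andP; split; lra.
  + by left.
  + by move=> z g l D; apply: vertex_weight_lt0; rewrite ?(subSS, subn0, sub0n); lra.
- apply: (@sparse_vertex V e R 7 (19732%:R / 100000%:R) (172%:R / 1000%:R) 0 0 0 isT free) A0.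
  + by apply/andP; split; lra.
  + by lra.
  + by rewrite [_.-1]/=; lra.
  + by apply/andP; split; lra.
  + by lra.
  + by apply/andP; split; lra.
  + by left.
  + by move=> z g l D; apply: vertex_weight_lt0; rewrite ?(subSS, subn0, sub0n); lra.
- apply: (@sparse_vertex V e R 8 (18068%:R / 100000%:R) (146%:R / 1000%:R) 0 (81932%:R / 100000%:R) (12%:R / 100%:R) isT free) A0.
  + by apply/andP; split; lra.
  + by lra.
  + by rewrite [_.-1]/=; lra.
  + by apply/andP; split; lra.
  + by lra.
  + by apply/andP; split; lra.
  + by right; split=> //; lra.
  + by move=> z g l D; exact: vertex_weight8.
Qed.

Theorem theorem2 (R : realType) (m : nat) (hm : (3 <= m <= 8)%N) :
  (forall (V : finType) (e : rel V),
     (0 < #|V|)%N -> simple_digraph e ->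
     (forall u : V, beta R m * #|V|%:R <= (outdeg e u)%:R) ->
     has_cycle_le m e)
  /\ ch R m <= beta R m.
Proof.
have main (V : finType) (e : rel V) : (0 < #|V|)%N ->
    (forall u : V, beta R m * #|V|%:R <= (outdeg e u)%:R) -> has_cycle_le m e.
  move=> V0 dense; apply: contrapT => free.
  have [|u _] := @sparse_vertex_beta V e R m hm free [set: V].
    by rewrite -card_gt0 cardsT.
  rewrite cardsT ltNge => /negP; apply.
  apply: le_trans (dense u) _; rewrite ler_nat deg_card finset.setTI.
  exact: leqnn.
split; first by move=> V e V0 _; exact: main.
have [_ _ least] := ch_least R m; apply: least.
  by case: m hm {main} => [|[|[|[|[|[|[|[|[|m]]]]]]]]] //= _; apply: divr_gt0; rewrite ltr0n.
by move=> V e V3 _; apply: main; exact: ltnW (ltnW V3).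
Qed.
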